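(* Let $P,Q\subset\mathbb R^3$ be lattice polytopes with $|P|=6$ and $|Q|=3$. Then $L(P+Q)\geq 3$.
   Context: $|P|$ is the number of lattice points of $P$. The Minkowski length $L(P)$ is the largest $L$ such that $P$ contains a Minkowski sum of $L$ lattice polytopes each of positive dimension. *)

(* Defs.v *)
From mathcomp Require Import all_boot all_order all_algebra.
From mathcomp Require Import finmap all_classical all_reals.
From mathcomp Require Import convex.

Set Implicit Arguments.
Unset Strict Implicit.
Unset Printing Implicit Defensive.

Import Order.TTheory GRing.Theory Num.Theory.

Local Open Scope classical_set_scope.
Local Open Scope ring_scope.

Definition lattice_pts (R : realType) (n : nat) : set 'rV[R]_n :=
  [set x | x \is a mxOver Num.int].

Definition conv_hull (R : realType) (n : nat) (A : set 'rV[R]_n) :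
  set 'rV[R]_n := smallest (@convex_set R 'rV[R]_n) A.

(* The empty set is allowed (it is the hull of [set0]). *)
Definition lattice_polytope (R : realType) (n : nat) (P : set 'rV[R]_n) :=
  exists2 V : set 'rV[R]_n,
    finite_set V /\ V `<=` @lattice_pts R n & P = conv_hull V.

(* [fset_set] is empty on infinite sets, so a positive value entails that the
   set of lattice points is finite. *)
Definition num_lattice_pts (R : realType) (n : nat) (P : set 'rV[R]_n) : nat :=
  #|` fset_set (P `&` @lattice_pts R n)|.

(* The points [x] and [x + row i M], for [i < k], are [k + 1] affinely
   independent points of [P]; the empty set gets dimension 0. *)
Definition aff_dim (R : realType) (n : nat) (P : set 'rV[R]_n) : nat :=
  (\max_(k < n.+1 | `[< exists (x : 'rV[R]_n) (M : 'M[R]_(k, n)),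
       [/\ P x, forall i, P (x + row i M)%R & row_free M] >]) k)%N.

Definition mink_sum (R : realType) (n : nat) (A B : set 'rV[R]_n) :
  set 'rV[R]_n := [set x + y | x in A & y in B].

Definition contains_mink_sum (R : realType) (n : nat) (P : set 'rV[R]_n)
    (L : nat) : Prop :=
  exists S : 'I_L -> set 'rV[R]_n,
    (forall i, lattice_polytope (S i) /\ (0 < aff_dim (S i))%N) /\
    \big[@mink_sum R n/[set 0]]_(i < L) S i `<=` P.

(* The default value 0 is returned when there is no largest [L]; for a lattice
   polytope this only occurs when [P] is empty or a single nonzero point. *)
Definition mink_length (R : realType) (n : nat) (P : set 'rV[R]_n) : nat :=
  xget 0%N [set L | contains_mink_sum P L /\
                    forall L', contains_mink_sum P L' -> (L' <= L)%N].

(* Main.v *)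
From Stdlib Require Import ZArith.
Require Import Defs.
From mathcomp Require Import all_boot all_order all_algebra.
From mathcomp Require Import finmap all_classical all_reals.
From mathcomp Require Import convex interval_inference.
From mathcomp Require Import ssrZ zify ring.

Set Implicit Arguments.
Unset Strict Implicit.
Unset Printing Implicit Defensive.

Import Order.TTheory GRing.Theory Num.Theory.

(** Let [K = P + Q].  Only six distinct lattice points [p] of [P] and three
    distinct lattice points [q] of [Q] matter: we look for a translate of a sum of
    three nonzero lattice segments inside [K].  Two lattice points of [K] that differ
    by a multiple [>= 3] of a lattice vector, or two parallel segments of lattice
    length two, are enough; so we may assume the [p]'s, and the [q]'s, pairwise
    distinct modulo 2.  Let [H] be the plane of (Z/2)^3 spanned by the differences of
    the [q]'s.  When [p_i = q_i + c] modulo 2 for [i = 1, 2, 3], either [K] contains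
    the required sum, or [p_i + q_i = p_j + q_j] for some [i <> j], or [p_i - q_i] is
    constant.  If the two residues missed by [P] lie in different cosets of [H], this
    applies to a triangle in each coset, and the resulting edges of [P] parallel to
    edges of [Q] give the three segments.  Otherwise four [p]'s fill a coset of [H];
    comparing its four triangles shows that [P] contains a translate of
    [{q_1, q_2, q_3}].

    The statement on triangles and this last configuration are settled by a finite
    search.  Points of [K] are written as integer combinations of unknown lattice
    vectors whose residues modulo 2 are known.  One closes the set of points under
    integral midpoints and centroids, and refines the unknowns by the linear relations
    modulo 2 and modulo 3 that exist for reasons of dimension. *)

(** * Certificate search *)

Section Search.
Local Open Scope Z_scope.

(** Coordinates with respect to a list of unknown lattice vectors. Missing entries count as zero;
    [veqb] still compares lists literally, which can only lose equalities. *)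
Definition vec := seq Z.

Fixpoint vadd (x y : vec) : vec :=
  match x, y with
  | [::], _ => y
  | _, [::] => x
  | a :: x', c :: y' => a + c :: vadd x' y'
  end.

Fixpoint veqb (x y : vec) : bool :=
  match x, y with
  | [::], [::] => true
  | a :: x', c :: y' => (a =? c) && veqb x' y'
  | _, _ => false
  end.

Definition vscale (k : Z) (x : vec) : vec := map (Z.mul k) x.
Definition vopp (x : vec) : vec := map Z.opp x.
Definition vsub (x y : vec) : vec := vadd x (vopp y).
Definition vunit (i : nat) : vec := rcons (nseq i 0) 1.

Definition vdiv (n : Z) (x : vec) : option vec :=
  let t := map (fun c => c / n) x in
  if veqb (vscale n t) x then Some t else None.

Fixpoint pmod3 (p : positive) : nat :=
  match p with
  | xH => 1
  | xO q => match pmod3 q with O => 0 | 1%N => 2 | _ => 1 end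
  | xI q => match pmod3 q with O => 1 | 1%N => 0 | _ => 2 end
  end.
Definition zdvd3 (z : Z) : bool :=
  match z with
  | Z0 => true
  | Zpos p | Zneg p => if pmod3 p is O then true else false
  end.

(* [filter2] and [filter3] only speed up the search: every division that passes them
   is verified in [vdiv]. *)
Fixpoint filter2 (x y : vec) : bool :=
  match x, y with
  | a :: x', c :: y' => Bool.eqb (Z.even a) (Z.even c) && filter2 x' y'
  | _, _ => true
  end.
Fixpoint filter3 (x y z : vec) : bool :=
  match x, y, z with
  | a :: x', c :: y', e :: z' => zdvd3 (a + (c + e)) && filter3 x' y' z'
  | _, _, _ => true
  end.

Fixpoint vpositive (x : vec) : bool :=
  match x with
  | [::] => true
  | Z0 :: x' => vpositive x'
  | Zpos _ :: _ => true
  | Zneg _ :: _ => false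
  end.

Definition drop_at (T : Type) (s : nat) (x : seq T) : seq T :=
  take s x ++ drop s.+1 x.

Fixpoint pmap_pairs (S T : Type) (f : S -> S -> option T) (s : seq S) : seq T :=
  if s is x :: s' then pmap (f x) s' ++ pmap_pairs f s' else [::].

Fixpoint has_pair (S : Type) (f : S -> S -> bool) (s : seq S) : bool :=
  if s is x :: s' then has (f x) s' || has_pair f s' else false.

(** * The residue group (Z/2)^3 *)

Definition bits := (bool * bool * bool)%type.
Definition bits0 : bits := (false, false, false).
Definition bxor (x y : bits) : bits :=
  (x.1.1 (+) y.1.1, x.1.2 (+) y.1.2, x.2 (+) y.2)%B.
Definition is_bits0 (x : bits) : bool := ~~ [|| x.1.1, x.1.2 | x.2].
Definition all_bits : seq bits :=
  [seq (x, c) | x <- [seq (a, b) | a <- [:: false; true],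
                                   b <- [:: false; true]],
                c <- [:: false; true]].

Fixpoint residue (res : seq bits) (x : vec) : bits :=
  match res, x with
  | r :: res', c :: x' =>
    if Z.odd c then bxor r (residue res' x') else residue res' x'
  | _, _ => bits0
  end.

(* [n] bounds the number of factors 2 and 3 that are removed from [x]. *)
Fixpoint nonzero (n : nat) (res : seq bits) (x : vec) : bool :=
  if is_bits0 (residue res x) then
    if n is n'.+1 then
      if vdiv 2 x is Some t then nonzero n' res t else
      if vdiv 3 x is Some t then nonzero n' res t else false
    else false
  else true.

(** * Patterns among the known points and changes of unknowns *)

Definition has_triple (res : seq bits) (D : seq vec) : bool :=
  has_pair (fun x y =>
    if filter3 x (vopp y) (map (fun=> 0) x) then
    if vdiv 3 (vsub x y) is Some t then nonzero 4 res t else false else false) D.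

(** Points [x] and [x + 2 u] are recorded as [(x, u)] with [u] oriented by [vpositive], so that
    equal parallel segments show the same [u]. *)
Definition doubles (D : seq vec) : seq (vec * vec) :=
  pmap_pairs (fun x y =>
    if filter2 x y then
      if vdiv 2 (vsub x y) is Some u then
         Some (if vpositive u then (y, u) else (x, vopp u))
      else None
    else None) D.

Definition parallel (res : seq bits) (S : seq (vec * vec)) : bool :=
  has_pair (fun p q => veqb p.2 q.2 && nonzero 4 res (vsub p.1 q.1)) S.

Definition add_new (D E : seq vec) : seq vec :=
  foldl (fun acc x => if has (veqb x) acc then acc else rcons acc x) D E.

Definition midpoints (S : seq (vec * vec)) : seq vec :=
  [seq vadd s.1 s.2 | s <- S].

Fixpoint centroids (D : seq vec) : seq vec :=
  if D is x :: D' then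
    pmap_pairs (fun y z => if filter3 x y z then vdiv 3 (vadd x (vadd y z)) else None) D'
    ++ centroids D'
  else [::].

(* If [mu] has coefficient 1 at [s] and [k u] is the vector with coordinates [mu], then
   [subst] replaces the unknown [s] by [u]; the new unknown comes first.  When [k = 0],
   [elim] just removes the unknown [s]. *)
Definition elim (s : nat) (mu x : vec) : vec :=
  drop_at s (vsub x (vscale (nth 0 x s) mu)).
Definition subst (s : nat) (k : Z) (mu x : vec) : vec :=
  k * nth 0 x s :: elim s mu x.

Definition pivot (f : vec) : Z :=
  foldr (fun c a => if c =? 0 then a
                    else if a =? 0 then Z.abs c
                    else Z.min (Z.abs c) a) 0 f.

(* One representative of each of the 40 lines of (Z/3)^4. *)
Definition lines : seq vec :=
  let t := [:: 0; 1; -1] in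
  [seq l <- foldr (fun _ ls => [seq a :: l | a <- t, l <- ls]) [:: [::]] (iota 0 4)
   | vpositive l && has (fun c => ~~ (c =? 0)) l].

Definition embed (pos : seq nat) (l : vec) : vec :=
  foldr (fun p acc => vadd (vscale p.2 (vunit p.1)) acc) [::] (zip pos l).

(* Branching, used when closing the set of points decides nothing.  [Halve mu] uses that
   the vector [mu] is even and branches on the residue of its half; [Third pos] branches
   on a linear relation modulo 3 between the four unknowns [pos].  Children that need no
   further branching are omitted.  The leaves [Zono] and [Line] exhibit a certificate. *)
Inductive tree :=
  | Stop
  | Halve of vec & seq (nat * tree)
  | Third of seq nat & seq (nat * tree)
  | Zono of vec & vec & vec & vec
  | Line of vec & vec & Z.

(** A child number is a position in [all_bits] below [Halve] and in [lines] below [Third]. *)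
Definition child (ts : seq (nat * tree)) (i : nat) : tree :=
  nth Stop (map snd ts) (index i (map fst ts)).

(* Two points [x + 2 u] and [x] with [u] even force [u = 0], since otherwise they are at
   lattice distance at least 4; the unknowns are then eliminated by Euclid's algorithm. *)
Definition check_step (rec : seq bits -> seq vec -> tree -> bool)
    (res : seq bits) (D : seq vec) (t : tree) : bool :=
  if has_triple res D then true else
  let S := doubles D in
  match [seq s.2 | s <- S & is_bits0 (residue res s.2)] with
  | f :: _ =>
    nonzero 4 res f ||
    let a := pivot f in
    let s := find (fun c => Z.abs c =? a) f in
    let u := if 0 <? nth 0 f s then f else vopp f in
    let mu := map (fun c => c / a) u in
    [&& ~~ (a =? 0), (nth 0 mu s =? 1) &
      if veqb (vscale a mu) u then
        rec (drop_at s res) (add_new [::] (map (elim s mu) D)) t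
      else
        rec (residue res mu :: drop_at s res)
              (map (subst s 1 mu) D) t]
  | [::] =>
    if parallel res S then true else
    let D' := add_new D (midpoints S) in
    if (size D < size D')%N then rec res D' t else
    let D'' := add_new D (centroids D) in
    if (size D < size D'')%N then rec res D'' t else
    match t with
    | Stop => false
    | Halve mu ts =>
      let s := find (Z.eqb 1) mu in
      let D2 := map (subst s 2 mu) D in
      [&& is_bits0 (residue res mu), (nth 0 mu s =? 1) &
        all (fun ir => rec (ir.2 :: drop_at s res) D2 (child ts ir.1))
            (zip (iota 0 8) all_bits)]
    | Third pos ts =>
      (size pos == 4%N) &&
      all (fun il => let mu := embed pos il.2 in
             let s := find (Z.eqb 1) mu in
             (nth 0 mu s =? 1) &&
             rec (residue res mu :: drop_at s res)
                   (map (subst s 3 mu) D) (child ts il.1))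
          (zip (iota 0 40) lines)
    | Zono z u v w =>
      [&& nonzero 4 res u, nonzero 4 res v, nonzero 4 res w &
        all (fun x => has (veqb x) D)
          [seq vadd x y | x <- [seq vadd x y | x <- [:: z; vadd z u], y <- [:: [::]; v]],
                          y <- [:: [::]; w]]]
    | Line x u k =>
      [&& 3 <=? k, nonzero 4 res u, has (veqb x) D & has (veqb (vadd x (vscale k u))) D]
    end
  end.

Fixpoint check (n : nat) : seq bits -> seq vec -> tree -> bool :=
  if n is n'.+1 then check_step (check n') else fun _ _ _ => false.

Definition sums (P Q : seq vec) : seq vec :=
  add_new [::] [seq vadd p q | p <- P, q <- Q].

Definition nbits (n : nat) : bits := nth bits0 all_bits n.

(** * Branching certificates and the point sets they concern *)

Definition tri_tree_plane : tree :=
  Third [:: 0; 1; 2; 3]%N [:: (3%N, Halve [:: 1; 1; 0; 0] [:: (0%N, Halve [:: 1; 0;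
    0; 0] [::]); (1%N, Halve [:: 1; 1; 0; 0] [::]); (4%N, Third [:: 0; 1; 2; 3]%N
    [:: (26%N, Third [:: 0; 1; 2; 3]%N [::]); (29%N, Third [:: 0; 1; 2; 3]%N
    [::])]); (5%N, Third [:: 0; 1; 2; 3]%N [:: (26%N, Third [:: 0; 1; 2; 3]%N [::]);
    (29%N, Third [:: 0; 1; 2; 3]%N [::])]); (6%N, Third [:: 0; 1; 2; 3]%N [:: (26%N,
    Third [:: 0; 1; 2; 3]%N [::]); (29%N, Third [:: 0; 1; 2; 3]%N [::])]); (7%N,
    Third [:: 0; 1; 2; 3]%N [:: (26%N, Third [:: 0; 1; 2; 3]%N [::]); (29%N, Third
    [:: 0; 1; 2; 3]%N [::])])])].
Definition tri_tree_space : tree :=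
  Third [:: 0; 1; 2; 3]%N [:: (3%N, Halve [:: 1; 0; 1; 1] [:: (0%N, Halve [:: 1; 0;
    0; 0] [::]); (1%N, Halve [:: 1; 1; 0; 0] [::]); (2%N, Halve [:: 1; 0; 1; 0]
    [::]); (3%N, Halve [:: 1; 1; 1; 0] [::]); (5%N, Halve [:: 1; 1; 0; 1] [::]);
    (7%N, Halve [:: 1; 1; 1; 1] [::])])].
Definition hex_tree_near : tree :=
  Third [:: 0; 1; 2; 3]%N [:: (2%N, Third [:: 1; 2; 3; 4]%N [:: (2%N, Halve [:: 1;
    0; 1; 0; 0] [:: (1%N, Third [:: 0; 1; 2; 3]%N [::])]); (26%N, Third [:: 0; 1; 2;
    3]%N [::])]); (3%N, Halve [:: 0; 1; 0; 1; 1] [:: (0%N, Third [:: 0; 2; 3; 4]%N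
    [:: (2%N, Third [:: 0; 1; 2; 3]%N [::]); (13%N, Third [:: 0; 1; 2; 3]%N [::])]);
    (2%N, Third [:: 0; 2; 3; 4]%N [::]); (3%N, Third [:: 0; 2; 3; 4]%N [::]); (6%N,
    Third [:: 0; 2; 3; 4]%N [:: (8%N, Third [:: 0; 1; 2; 3]%N [::])]); (7%N, Third
    [:: 0; 2; 3; 4]%N [::])]); (8%N, Third [:: 1; 2; 3; 4]%N [:: (6%N, Halve [:: 0;
    0; 1; 1; 1] [:: (6%N, Third [:: 0; 1; 2; 3]%N [:: (8%N, Zono [:: 0; 1; 0] [:: 1;
    -1; 0] [:: 4; -2; -1] [:: 6; -3; -2])])]); (29%N, Third [:: 0; 1; 2; 3]%N [::]);
    (33%N, Third [:: 0; 1; 2; 3]%N [::])]); (17%N, Third [:: 1; 2; 3; 4]%N [:: (6%N,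
    Halve [:: 1; 1; 0; 0; 0] [:: (1%N, Third [:: 0; 1; 2; 3]%N [::])]); (29%N, Third
    [:: 0; 1; 2; 3]%N [::])]); (26%N, Third [:: 0; 1; 2; 3]%N [::]); (29%N, Halve
    [:: 0; 0; 1; 1; 0] [:: (3%N, Third [:: 0; 1; 2; 3]%N [:: (17%N, Third [:: 0; 1;
    2; 3]%N [::]); (18%N, Third [:: 0; 1; 2; 3]%N [::]); (32%N, Third [:: 0; 1; 2;
    3]%N [::]); (36%N, Third [:: 0; 1; 2; 3]%N [::])])]); (35%N, Third [:: 0; 1; 2;
    3]%N [::]); (39%N, Third [:: 0; 1; 2; 3]%N [::])].
Definition hex_tree_far : tree :=
  Halve [:: 1; 0; 0; 1; 1] [:: (0%N, Third [:: 0; 1; 3; 4]%N [:: (2%N, Third [:: 0;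
    1; 2; 3]%N [:: (2%N, Third [:: 0; 1; 2; 3]%N [::]); (3%N, Third [:: 0; 1; 2;
    3]%N [::])]); (12%N, Halve [:: 0; 1; 0; 0; 0] [::]); (13%N, Third [:: 0; 1; 2;
    3]%N [:: (6%N, Third [:: 0; 1; 2; 3]%N [::]); (10%N, Third [:: 0; 1; 2; 3]%N
    [::])]); (22%N, Third [:: 0; 1; 2; 3]%N [::]); (39%N, Halve [:: 1; 1; 0; 1; 1]
    [::])]); (1%N, Third [:: 0; 1; 3; 4]%N [:: (12%N, Third [:: 1; 2; 3; 4]%N [::]);
    (21%N, Zono [:: 0; 0; 1; 1] [:: 0; 0; 0; 1] [:: 0; 0; 1; 0] [:: 0; 0; -1; -1]);
    (39%N, Third [:: 1; 2; 3; 4]%N [::])]); (2%N, Third [:: 0; 1; 3; 4]%N [:: (31%N,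
    Third [:: 0; 1; 2; 3]%N [::]); (39%N, Halve [:: 1; 0; 0; 1; 1] [::])]); (3%N,
    Third [:: 0; 1; 3; 4]%N [:: (12%N, Halve [:: 1; 1; 0; 0; 0] [::]); (30%N, Third
    [:: 0; 1; 2; 3]%N [::])]); (4%N, Third [:: 0; 1; 3; 4]%N [:: (12%N, Third [:: 0;
    1; 2; 3]%N [::]); (39%N, Third [:: 1; 2; 3; 4]%N [:: (10%N, Third [:: 0; 1; 2;
    3]%N [::])])]); (5%N, Third [:: 0; 1; 3; 4]%N [:: (12%N, Third [:: 1; 2; 3; 4]%N
    [:: (6%N, Third [:: 0; 1; 2; 3]%N [::])]); (39%N, Third [:: 0; 1; 2; 3]%N
    [::])])].
Definition hex_tree_center : tree :=
  Halve [:: 1; 1; 1; 0; 0] [:: (0%N, Halve [:: 1; 0; 0; 0; 0] [::]); (4%N, Third [::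
    0; 1; 2; 3]%N [:: (2%N, Third [:: 0; 1; 2; 3]%N [:: (23%N, Line [:: -5; 0; 1; 0]
    [:: 1; 0; 0; 0] 5)]); (3%N, Third [:: 0; 1; 2; 3]%N [::]); (8%N, Halve [:: 0; 1;
    0; 1; 0] [::]); (24%N, Halve [:: 1; 1; 0; 0; 0] [::]); (33%N, Zono [:: 5; 1; -1;
    2; 0] [:: 1; 0; 0; 0; 0] [:: 3; 1; -1; 1; 0] [:: -3; 0; 0; -1; 0]); (38%N, Zono
    [:: 3; 1; 0; -1; 0] [:: 1; 0; 0; 0; 0] [:: 3; 1; 0; -1; 0] [:: -3; 0; 0; 1;
    0])]); (5%N, Third [:: 0; 1; 2; 3]%N [:: (2%N, Halve [:: 1; 1; 1; 0; 0] [::]);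
    (3%N, Third [:: 0; 1; 2; 3]%N [::]); (8%N, Halve [:: 1; 1; 0; 0; 0] [::]);
    (15%N, Zono [:: 2; 1; -1; 1; 0] [:: 1; 0; 0; 0; 0] [:: 3; -1; 0; 1; 0] [:: 3;
    -1; -1; 1; 0]); (24%N, Third [:: 0; 1; 2; 3]%N [:: (39%N, Line [:: -10; -5; -4;
    0] [:: 2; 1; 1; 0] 5)]); (33%N, Zono [:: 5; 1; -1; 2; 0] [:: 1; 0; 0; 0; 0] [::
    3; 1; -1; 1; 0] [:: -3; 0; 0; -1; 0])]); (6%N, Third [:: 0; 1; 2; 3]%N [:: (2%N,
    Halve [:: 0; 1; 1; 1; 0] [::]); (3%N, Third [:: 0; 1; 2; 3]%N [::]); (8%N, Third
    [:: 0; 1; 2; 3]%N [:: (27%N, Line [:: -5; 2; 2; 0] [:: 1; 0; -1; 0] 5)]); (15%N,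
    Zono [:: 2; 1; -1; 1; 0] [:: 1; 0; 0; 0; 0] [:: 3; -1; 0; 1; 0] [:: 3; -1; -1;
    1; 0]); (24%N, Halve [:: 1; 0; 0; 0; 0] [::]); (38%N, Zono [:: 3; 1; 0; -1; 0]
    [:: 1; 0; 0; 0; 0] [:: 3; 1; 0; -1; 0] [:: -3; 0; 0; 1; 0])]); (7%N, Third [::
    0; 1; 2; 4]%N [:: (2%N, Halve [:: 0; 1; 1; 0; 1] [::]); (3%N, Third [:: 0; 1; 2;
    4]%N [::]); (8%N, Third [:: 0; 1; 2; 4]%N [:: (27%N, Line [:: -5; 2; 2; 0] [::
    1; 0; -1; 0] 5)]); (15%N, Zono [:: 2; 1; -1; 0; 1] [:: 1; 0; 0; 0; 0] [:: 3; -1;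
    0; 0; 1] [:: 3; -1; -1; 0; 1]); (24%N, Halve [:: 1; 0; 0; 0; 0] [::]); (38%N,
    Zono [:: 3; 1; 0; 0; -1] [:: 1; 0; 0; 0; 0] [:: 3; 1; 0; 0; -1] [:: -3; 0; 0; 0;
    1])])].

(* With [p_l = a_l + b_l] and [q_l = o + a_l - b_l], the unknowns are [a_j - a_k],
   [a_k - a_i], [b_j - b_k], [b_k - b_i], and the points are relative to [p_k], [q_k]. *)
Definition tri_sums : seq vec :=
  sums [:: [:: 0; -1; 0; -1]; [:: 1; 0; 1; 0]; [:: 0; 0; 0; 0]]
       [:: [:: 0; -1; 0; 1]; [:: 1; 0; -1; 0]; [:: 0; 0; 0; 0]].

(* The unknowns are [q_j - q_i], [q_k - q_i], a vector [r] and two further points of [P];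
   [P] contains the translate of the three [q]'s and a point [q_j + q_k - q_i - 2 r]. *)
Definition hex_sums : seq vec :=
  sums [:: [:: 0; 0; 0; 0; 0]; [:: 1; 0; 0; 0; 0]; [:: 0; 1; 0; 0; 0];
           [:: 1; 1; -2; 0; 0]; [:: 0; 0; 0; 1; 0]; [:: 0; 0; 0; 0; 1]]
       [:: [:: 0; 0; 0; 0; 0]; [:: 1; 0; 0; 0; 0]; [:: 0; 1; 0; 0; 0]].
End Search.

(** * Lattice zonotopes *)

Local Open Scope ring_scope.

Notation lat := 'rV[Z]_3.

(** Natural weights express rational convex combinations without leaving the lattice. Three points
    suffice for segments and centroids. *)
Definition lat_convex (K : lat -> Prop) : Prop :=
  forall (a c e : nat) (x y z w : lat), K x -> K y -> K z ->
  (0 < a + c + e)%N -> w *+ (a + c + e) = x *+ a + y *+ c + z *+ e -> K w.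

Definition has_zonotope (K : lat -> Prop) : Prop :=
  exists z u v w : lat, [/\ u != 0, v != 0, w != 0 &
    forall a c e : bool, K (z + u *+ a + v *+ c + w *+ e)].

Lemma lat_scaler_eq0 (k : Z) (x : lat) : k != 0 -> k *: x = 0 -> x = 0.
Proof.
move=> k0 /rowP E; apply/rowP => i; move: (E i); rewrite !mxE.
by move/eqP; rewrite mulf_eq0 (negPf k0) => /eqP.
Qed.

Lemma lat_convex_shift (K : lat -> Prop) (o : lat) :
  lat_convex K -> lat_convex (fun x => K (o + x)).
Proof.
move=> Kc a c e x y z w Kx Ky Kz n0 E; apply: (Kc a c e _ _ _ _ Kx Ky Kz n0).
by rewrite !mulrnDl E !mulrnDr addrACA (addrACA (o *+ a)).
Qed.

Lemma has_zonotope_shift (K : lat -> Prop) (o : lat) :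
  has_zonotope (fun x => K (o + x)) -> has_zonotope K.
Proof.
by case=> z [u [v [w [u0 v0 w0 Kz]]]]; exists (o + z), u, v, w; split=> // a c e;
  move: (Kz a c e); rewrite !addrA.
Qed.

(** * Criteria for a zonotope *)

Section Certificates.
Variable K : lat -> Prop.
Hypothesis Kc : lat_convex K.

Lemma conv_mid (x y z : lat) : K x -> K y -> x + y = z *+ 2 -> K z.
Proof.
move=> Kx Ky E; apply: (Kc (a := 1) (c := 1) (e := 0) Kx Ky Kx) => //.
by rewrite mulr0n addr0 !mulr1n E.
Qed.

Lemma conv_centroid (x y z w : lat) :
  K x -> K y -> K z -> x + y + z = w *+ 3 -> K w.
Proof.
by move=> Kx Ky Kz E; apply: (Kc (a := 1) (c := 1) (e := 1) Kx Ky Kz);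
  rewrite ?mulr1n ?E.
Qed.

Lemma conv_line (x t : lat) (n j : nat) :
  K x -> K (x + t *+ n) -> (0 < n)%N -> (j <= n)%N -> K (x + t *+ j).
Proof.
move=> Kx Ky n0 jn; apply: (Kc (a := (n - j)%N) (c := j) (e := 0) Kx Ky Kx).
  by rewrite addn0 subnK.
rewrite mulr0n !addr0 addn0 subnK // !mulrnDl addrA -mulrnDr subnK //.
by rewrite -!mulrnA mulnC.
Qed.

Lemma zonotope_line (x t : lat) (n : nat) :
  K x -> K (x + t *+ n) -> (3 <= n)%N -> t != 0 -> has_zonotope K.
Proof.
move=> Kx Kn n3 t0; exists x, t, t, t; split=> // a c e.
rewrite -!addrA -!mulrnDr; apply: conv_line Kn _ _ => //; first by case: n n3.
by apply: leq_trans n3; case: a c e => [] [] [].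
Qed.

(** The segments are [u], [u] and [y - x]: [e] selects one of the two given segments, and [a + c]
    its start, middle or end. *)
Lemma zonotope_parallel (x y u : lat) : K x -> K (x + u *+ 2) ->
  K y -> K (y + u *+ 2) -> x != y -> u != 0 -> has_zonotope K.
Proof.
move=> Kx Kx2 Ky Ky2 xy u0; exists x, u, u, (y - x).
split=> //; first by rewrite subr_eq0 eq_sym.
have ac (a c : bool) : (a + c <= 2)%N by case: a c => [] [].
move=> a c e; rewrite -(addrA x) -mulrnDr; case: e.
  by rewrite mulr1n addrAC addrCA subrr addr0; apply: conv_line Ky2 _ _.
by rewrite mulr0n addr0; apply: conv_line Kx2 _ _.
Qed.

End Certificates.

(** * Evaluation of coordinate vectors *)

Fixpoint ev (b : seq lat) (x : vec) : lat :=
  match b, x with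
  | v :: b', c :: x' => c *: v + ev b' x'
  | _, _ => 0
  end.

Lemma ev_nil b : ev b [::] = 0. Proof. by case: b. Qed.

Lemma evD b x y : ev b (vadd x y) = ev b x + ev b y.
Proof.
elim: b x y => [|v b IH] [|c x] [|d y] //=; rewrite ?addr0 ?add0r //.
by rewrite IH (scalerDl v c d : (c + d)%Z *: v = _) addrACA.
Qed.

Lemma evZ b k x : ev b (vscale k x) = k *: ev b x.
Proof.
elim: b x => [|v b IH] [|c x] //=; rewrite ?scaler0 // IH scalerDr scalerA.
by [].
Qed.

Lemma evN b x : ev b (vopp x) = - ev b x.
Proof.
elim: b x => [|v b IH] [|c x] //=; rewrite ?oppr0 // IH opprD.
by rewrite (scaleNr c v : (Z.opp c) *: v = _).
Qed.

Lemma evB b x y : ev b (vsub x y) = ev b x - ev b y.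
Proof. by rewrite evD evN. Qed.

Lemma veqbP x y : veqb x y -> x = y.
Proof.
elim: x y => [|a x IH] [|c y] //= /andP[/Z.eqb_eq-> /IH->] //.
Qed.

Lemma ev_vdiv b n x t : vdiv n x = Some t -> ev b x = n *: ev b t.
Proof. by rewrite /vdiv; case: ifP => // /veqbP E [<-]; rewrite -evZ E. Qed.

Lemma ev_drop_at b s x : nth Z0 x s = Z0 -> ev (drop_at s b) (drop_at s x) = ev b x.
Proof.
elim: s b x => [|s IH] [|v b] [|c x] //=.
- by rewrite /drop_at /= ?drop0 ev_nil.
- by rewrite /drop_at /= !drop0 => ->; rewrite scale0r add0r.
- by move=> E; congr (_ + _); apply: IH.
Qed.

Lemma nth_vsub s x y : nth Z0 (vsub x y) s = Z.sub (nth Z0 x s) (nth Z0 y s).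
Proof.
have addE z : nth Z0 (vadd x z) s = Z.add (nth Z0 x s) (nth Z0 z s).
  by elim: s x z => [|n IH] [|c x'] [|d z] //=; rewrite ?nth_nil; try lia.
rewrite addE; congr (Z.add _ _).
by elim: s y {addE} => [|n IH] [|d y] //=; rewrite ?nth_nil.
Qed.

Lemma nth_vscale s k x : nth Z0 (vscale k x) s = Z.mul k (nth Z0 x s).
Proof. by elim: s x => [|s IH] [|c x] //=; rewrite ?nth_nil; lia. Qed.

Lemma ev_elim b s mu x : nth Z0 mu s = Zpos xH ->
  ev (drop_at s b) (elim s mu x) = ev b x - nth Z0 x s *: ev b mu.
Proof.
move=> E; rewrite /elim ev_drop_at ?evB ?evZ //.
by rewrite nth_vsub nth_vscale E; lia.
Qed.

(** In [x = (x - x_s mu) + x_s mu] the first term is free of the unknown [s], and the second is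
    [k x_s] times the new unknown [u]. *)
Lemma ev_subst b s k mu x u : nth Z0 mu s = Zpos xH -> ev b mu = k *: u ->
  ev (u :: drop_at s b) (subst s k mu x) = ev b x.
Proof.
move=> E Eu; rewrite /= ev_elim // Eu addrC -addrA scalerA.
by rewrite (_ : Z.mul k _ = nth Z0 x s * k) ?addNr ?addr0 // Z.mul_comm.
Qed.

(** * Soundness of the search *)

Lemma scaleZ_nat (n : nat) (x : lat) : Z.of_nat n *: x = x *+ n.
Proof.
elim: n => [|n IH]; first by rewrite scale0r.
rewrite Nat2Z.inj_succ mulrSr -IH.
by rewrite (scalerDl x (Z.of_nat n) (Zpos xH) : (Z.succ _) *: x = _) scale1r.
Qed.

Lemma scaleZ2 (x : lat) : Zpos 2 *: x = x *+ 2. Proof. exact: (scaleZ_nat 2). Qed.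
Lemma scaleZ3 (x : lat) : Zpos 3 *: x = x *+ 3. Proof. exact: (scaleZ_nat 3). Qed.

Lemma bxorC : commutative bxor.
Proof. by move=> [[a b] c] [[d e] f]; rewrite /bxor /= (addbC a) (addbC b) (addbC c). Qed.

Lemma bxor0 x : bxor x bits0 = x.
Proof. by case: x => [[[] []] []]. Qed.

Lemma bxorxx x : bxor x x = bits0.
Proof. by case: x => [[[] []] []]. Qed.

Lemma is_bits0P x : reflect (x = bits0) (is_bits0 x).
Proof. by case: x => [[[] []] []]; constructor. Qed.

Lemma all_bitsP x : x \in all_bits.
Proof. by case: x => [[[] []] []]. Qed.

Section Membership.
Variables (S : eqType).

Lemma pmap_pairsP (T : eqType) (f : S -> S -> option T) s z :
  z \in pmap_pairs f s -> exists x y, [/\ x \in s, y \in s & f x y = Some z].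
Proof.
elim: s => //= x s IH; rewrite mem_cat => /orP[|/IH[y [w [ys ws E]]]].
  rewrite mem_pmap => /mapP[y ys /esym E]; exists x, y.
  by rewrite mem_head inE ys orbT.
by exists y, w; rewrite !inE ys ws !orbT.
Qed.

Lemma has_pairP (f : S -> S -> bool) s :
  has_pair f s -> exists x y, [/\ x \in s, y \in s & f x y].
Proof.
elim: s => //= x s IH /orP[/hasP[y ys fxy]|/IH[y [w [ys ws E]]]].
  by exists x, y; rewrite mem_head inE ys orbT.
by exists y, w; rewrite !inE ys ws !orbT.
Qed.

End Membership.

Lemma has_veqb x D : has (veqb x) D -> x \in D.
Proof. by case/hasP => y yD /veqbP->. Qed.

Lemma mem_add_new D E x : x \in add_new D E -> x \in D \/ x \in E.
Proof.
rewrite /add_new; elim: E D => [|y E IH] D /=; first by left.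
case/IH => [|xE]; last by right; rewrite inE xE orbT.
case: ifP => _; first by left.
by rewrite mem_rcons inE => /orP[/eqP->|]; [right; rewrite mem_head|left].
Qed.

Lemma mem_doubles D s : s \in doubles D ->
  s.1 \in D /\ exists2 y, y \in D & forall b, ev b y = ev b s.1 + ev b s.2 *+ 2.
Proof.
case/pmap_pairsP => x [y [xD yD]]; case: ifP => // _.
case E: (vdiv 2 (vsub x y)) => [u|] // [].
have Eb b : ev b x - ev b y = ev b u *+ 2 by rewrite -evB (ev_vdiv b E) scaleZ2.
case: ifP => _ <- /=; split=> //.
  by exists x => // b; rewrite -Eb addrC subrK.
by exists y => // b; rewrite evN mulNrn -Eb opprB addrC subrK.
Qed.

Lemma mem_centroids D g : g \in centroids D -> exists x y z,
  [/\ x \in D, y \in D, z \in D & forall b, ev b x + ev b y + ev b z = ev b g *+ 3].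
Proof.
elim: D => //= x D IH; rewrite mem_cat => /orP[|/IH[y [z [w [yD zD wD E]]]]].
  case/pmap_pairsP => y [z [yD zD]]; case: ifP => // _ E.
  exists x, y, z; rewrite mem_head !inE yD zD !orbT; split=> // b.
  by rewrite -scaleZ3 -(ev_vdiv b E) !evD addrA.
by exists y, z, w; rewrite !inE yD zD wD !orbT.
Qed.

Lemma ev_embed b pos l :
  ev b (embed pos l) = ev [seq ev b (vunit p) | p <- pos] l.
Proof.
elim: pos l => [|p pos IH] [|c l] //=; rewrite /embed /= ?ev_nil //.
by rewrite evD evZ -IH.
Qed.

(** Four vectors of (Z/3)^3 are linearly dependent. The relation is found in the left kernel of a 4
    by 3 matrix and lifted to coefficients 0, 1, -1; up to sign it is listed in [lines]. *)
Lemma third_ex (w : seq lat) : size w = 4%N ->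
  exists2 l, l \in lines & exists u, ev w l = u *+ 3.
Proof.
case: w => [|w0 [|w1 [|w2 [|w3 [|]]]]] // _.
pose r3 (c : Z) : 'F_3 := (int_of_Z c)%:~R.
pose lift3 (a : 'F_3) : Z := if a == 0 then Z0 else if a == 1 then 1 else (-1).
have lift3K a : r3 (lift3 a) = a.
  by rewrite /lift3 /r3; case: a => [[|[|[|]]] //] ltn3; apply/val_inj.
have r3M : {morph r3 : x y / x * y} by move=> x y; rewrite /r3 rmorphM intrM.
have r3D : {morph r3 : x y / x + y} by move=> x y; rewrite /r3 rmorphD intrD.
have r3_eq0 c : r3 c = 0 -> Z.modulo c (Zpos 3) = Z0.
  have n3 : Zpos 3 <> Z0 by [].
  have r33 : r3 (Zpos 3) = 0 by apply/val_inj.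
  rewrite [in r3 c](Z.div_mod c (Zpos 3) n3) (r3D (Z.mul _ _) (Z.modulo c _)).
  rewrite (r3M (Zpos 3)) r33 mul0r add0r.
  have [->|[->|->]] // : Z.modulo c (Zpos 3) = Z0 \/
      Z.modulo c (Zpos 3) = Zpos 1 \/ Z.modulo c (Zpos 3) = Zpos 2.
    by have := Z.mod_pos_bound c (Zpos 3); lia.
pose W : 'M[Z]_(4, 3) := \matrix_(i < 4) nth 0 [:: w0; w1; w2; w3] i.
pose M := map_mx r3 W.
have : kermx M != 0.
  rewrite kermx_eq0; apply: contraTN (rank_leq_col M) => /eqP->.
  by [].
rewrite -nz_row_eq0; set v := nz_row _ => v0.
have vM : v *m M = 0 by apply/sub_kermxP; apply: nz_row_sub.
pose i1 : 'I_4 := lift ord0 ord0; pose i2 : 'I_4 := lift ord0 (lift ord0 ord0).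
pose i3 : 'I_4 := lift ord0 (lift ord0 (lift ord0 ord0)).
pose l : vec := [seq lift3 (v 0 i) | i <- [:: ord0; i1; i2; i3]].
have ll : l \in lines \/ vopp l \in lines.
  have : [|| v 0 ord0 != 0, v 0 i1 != 0, v 0 i2 != 0 | v 0 i3 != 0].
    apply: contraNT v0; rewrite !negb_or !negbK => /and4P[/eqP e0 /eqP e1 /eqP e2 /eqP e3].
    apply/eqP/rowP => -[[|[|[|[|//]]]] lti]; rewrite mxE;
      [rewrite -[RHS]e0|rewrite -[RHS]e1|rewrite -[RHS]e2|rewrite -[RHS]e3];
      by congr (v 0 _); apply: val_inj.
  rewrite /l /=; move: (v 0 ord0) (v 0 i1) (v 0 i2) (v 0 i3).
  by move=> [[|[|[|//]]] ?] [[|[|[|//]]] ?] [[|[|[|//]]] ?] [[|[|[|//]]] ?] H;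
    first [left; done|right; done|discriminate H].
have [u Eu] : exists u, ev [:: w0; w1; w2; w3] l = u *+ 3.
  have E3 i : Z.modulo (ev [:: w0; w1; w2; w3] l 0 i) (Zpos 3) = Z0.
    apply: r3_eq0; have := congr1 (fun A : 'rV_3 => A 0 i) vM.
    rewrite mxE [RHS]mxE => <-; rewrite !big_ord_recl big_ord0 /= !mxE.
    by rewrite !r3D !r3M !lift3K /=; do 4!congr (_ + _).
  move: (ev _ l) E3 => x E3; exists (map_mx (fun c => Z.div c (Zpos 3)) x).
  apply/rowP => i; rewrite mulmxnE mxE; move: (E3 i) => E.
  by rewrite {1}(Z.div_mod (x 0 i) (Zpos 3)) // E !mulrS mulr0n; lia.
case: ll => ll; [by exists l => //; exists u|exists (vopp l) => //].
by exists (- u); rewrite evN Eu mulNrn.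
Qed.

Section Soundness.
(** [rho] is reduction modulo 2 in coordinates of choice; this freedom lets one certificate serve
    every basis of (Z/2)^3. *)
Variables (rho : lat -> bits) (K : lat -> Prop).
Hypothesis rhoD : forall x y, rho (x + y) = bxor (rho x) (rho y).
Hypothesis rho_ker : forall x, rho x = bits0 -> exists y, x = y *+ 2.
Hypothesis Kc : lat_convex K.

Lemma rho0 : rho 0 = bits0.
Proof. by rewrite -(bxorxx (rho 0)) -rhoD addr0. Qed.

Lemma rho_double x : rho (x *+ 2) = bits0.
Proof. by rewrite mulr2n rhoD bxorxx. Qed.

Lemma rhoZ c x : rho (c *: x) = if Z.odd c then rho x else bits0.
Proof.
have even2 d : rho (Z.mul 2 d *: x) = bits0.
  rewrite (_ : Z.mul 2 d *: x = Zpos 2 *: (d *: x)); last by rewrite scalerA.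
  by rewrite scaleZ2 rho_double.
rewrite {1}(Z.div2_odd c); case: (Z.odd c) => /=; last by rewrite Z.add_0_r even2.
by rewrite (scalerDl x _ (Zpos 1) : (Z.add _ _) *: x = _) rhoD even2 scale1r bxorC bxor0.
Qed.

Lemma rho_ev b x : rho (ev b x) = residue (map rho b) x.
Proof.
elim: b x => [|v b IH] [|c x] //=; rewrite ?rho0 //.
by rewrite rhoD rhoZ IH; case: (Z.odd c) => //; rewrite bxorC bxor0.
Qed.

(** A nonzero residue excludes the zero vector, and a quotient by 2 or 3 vanishes only with the
    vector itself. *)
Lemma nonzeroP n b x : nonzero n (map rho b) x -> ev b x != 0.
Proof.
have base y : ~~ is_bits0 (residue (map rho b) y) -> ev b y != 0.
  by move=> /is_bits0P H; apply/eqP => E; apply: H; rewrite -rho_ev E rho0.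
have dv k y t : vdiv k y = Some t -> ev b t != 0 -> k != 0 -> ev b y != 0.
  move=> E t0 k0; apply: contraNneq t0; rewrite (ev_vdiv b E).
  by move=> /(lat_scaler_eq0 k0)->.
elim: n x => [|n IH] x /=; case: ifP => [_|/negbT/base] //.
case E2: (vdiv 2 x) => [t|]; first by move=> /IH t0; apply: dv E2 t0 _.
by case E3: (vdiv 3 x) => [t|] // /IH t0; apply: dv E3 t0 _.
Qed.

Lemma map_drop_at b s : map rho (drop_at s b) = drop_at s (map rho b).
Proof. by rewrite /drop_at map_cat map_take map_drop. Qed.

(** Induction on the fuel [n]: each step exhibits a zonotope or changes unknowns and points so that
    all points still evaluate into [K]. *)
Lemma check_sound n t D b :
  check n (map rho b) D t -> (forall x, x \in D -> K (ev b x)) -> has_zonotope K.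
Proof.
elim: n t D b => [//|n IH] t D b; set res := map rho b => ck KD.
move: ck; rewrite -[check _ _ _ _]/(check_step (check n) res D t) /check_step => ck.
case: ifP ck => [/has_pairP[x [y [xD yD]]] F _|_].
  move: F; case: ifP => // _; case E: (vdiv 3 (vsub x y)) => [d|] // /nonzeroP d0.
  apply: (zonotope_line (n := 3) Kc (KD _ yD) _ _ d0) => //.
  by rewrite -scaleZ3 -(ev_vdiv b E) evB addrC subrK; apply: KD.
have reduce mu s k u t' D' : nth Z0 mu s = Zpos xH -> ev b mu = k *: u ->
    (forall x, x \in D' -> x \in map (subst s k mu) D) ->
    check n (rho u :: drop_at s res) D' t' -> has_zonotope K.
  move=> mus Eu sub ck; apply: (IH t' D' (u :: drop_at s b)).
    by rewrite /= map_drop_at.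
  by move=> x /sub/mapP[y yD ->]; rewrite (ev_subst _ mus Eu); apply: KD.
case Ef: [seq _ | _ <- _ & _] => [|f fs].
  (* A zero direction has zero residue and would appear in the list just assumed empty. *)
  have Snz s : s \in doubles D -> ev b s.2 != 0.
    move=> sS; apply/eqP => s0.
    have: s \in [seq s <- doubles D | is_bits0 (residue res s.2)].
      by rewrite mem_filter sS -rho_ev s0 rho0.
    by case: [seq _ <- _ | _] Ef.
  case: ifP => [/has_pairP[[x u] [[y v] []]]|_].
    move=> xS yS /andP[/veqbP Euv /nonzeroP xy] _; move: Euv xy => /= Euv xy.
    have /= [xD [x2 x2D Ex]] := mem_doubles xS.
    have /= [yD [y2 y2D Ey]] := mem_doubles yS; have /= u0 := Snz _ xS.
    apply: (zonotope_parallel Kc (KD _ xD) _ (KD _ yD) _ _ u0).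
    - by rewrite -Ex; apply: KD.
    - by rewrite Euv -Ey; apply: KD.
    - by move: xy; rewrite evB subr_eq0.
  case: ifP => [_ /IH|_].
    apply=> x /mem_add_new[/KD //|/mapP[s /mem_doubles[sD [y yD Ey]] ->]].
    apply: (conv_mid Kc (KD _ sD) (KD _ yD)).
    by rewrite Ey evD mulrnDl addrA -mulr2n.
  case: ifP => [_ /IH|_].
    apply=> x /mem_add_new[/KD //|/mem_centroids[y [z [w [yD zD wD E]]]]].
    exact: (conv_centroid Kc (KD _ yD) (KD _ zD) (KD _ wD) (E b)).
  case: t => [//|mu ts|pos ts|z u v w|x u k].
  - case/and3P => /is_bits0P mu0 /Z.eqb_eq mus /allP ck.
    have [u Eu] : exists u, ev b mu = u *+ 2 by apply: rho_ker; rewrite rho_ev.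
    (* Of the eight branches, take the one for the actual residue of the half [u]. *)
    have iN : (index (rho u) all_bits < 8)%N by rewrite index_mem all_bitsP.
    rewrite -scaleZ2 in Eu.
    apply: (reduce _ _ _ _ _ _ mus Eu (fun x xD => xD)).
    apply: (ck (index (rho u) all_bits, rho u)).
    rewrite -[(_, _)]/((index (rho u) all_bits, rho u)).
    have -> : (index (rho u) all_bits, rho u) =
       nth (0%N, bits0) (zip (iota 0 8) all_bits) (index (rho u) all_bits).
      by rewrite nth_zip // nth_iota // nth_index // all_bitsP.
    by rewrite mem_nth.
  - case/andP => /eqP sz /allP ck.
    have [|l ll [u Eu]] := @third_ex [seq ev b (vunit p) | p <- pos].
      by rewrite size_map.
    have iN : (index l lines < 40)%N by rewrite index_mem.
    have /ck /= /andP[/Z.eqb_eq mus] : (index l lines, l) \in zip (iota 0 40) lines.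
      have -> : (index l lines, l) =
         nth (0%N, [::]) (zip (iota 0 40) lines) (index l lines).
        by rewrite nth_zip // nth_iota // nth_index.
      by rewrite mem_nth.
    rewrite -ev_embed -scaleZ3 in Eu.
    have <- : rho u = residue res (embed pos l).
      by rewrite -rho_ev Eu rhoZ.
    exact: (reduce _ _ _ _ _ _ mus Eu (fun x xD => xD)).
  - case/and4P => /nonzeroP u0 /nonzeroP v0 /nonzeroP w0 /allP ck.
    exists (ev b z), (ev b u), (ev b v), (ev b w); split=> // a c e.
    have -> : ev b z + ev b u *+ a + ev b v *+ c + ev b w *+ e =
      ev b (vadd (vadd (if a then vadd z u else z) (if c then v else [::]))
                 (if e then w else [::])).
      by rewrite !evD; case: a c e => [] [] []; rewrite ?evD ?ev_nil ?mulr0n ?addr0.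
    apply: KD; apply: has_veqb; apply: ck.
    by case: a c e => [] [] []; rewrite !inE eqxx ?orbT.
  - case/and4P => /Z.leb_le k3 /nonzeroP u0 /has_veqb xD /has_veqb yD.
    apply: (zonotope_line (n := Z.to_nat k) Kc (KD _ xD) _ _ u0); last by lia.
    by rewrite -scaleZ_nat Z2Nat.id -?evZ -?evD; [apply: KD|lia].
have : f \in [seq s.2 | s <- doubles D & is_bits0 (residue res s.2)].
  by rewrite Ef mem_head.
case/mapP => x; rewrite mem_filter => /andP[/is_bits0P x0 /mem_doubles[xD]].
case=> y yD /(_ b) Exy Efx; move: x0; rewrite -Efx in Exy *.
rewrite -rho_ev => /rho_ker[t' Et'].
(* Here [y = x + 4 t']: a nonzero [t'] gives four lattice steps in a line, and otherwise [f]
   evaluates to zero. *)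
have [t0|t0] := eqVneq t' 0; last first.
  move=> _; apply: (zonotope_line (n := 4) Kc (KD _ xD) _ _ t0) => //.
  by rewrite (mulrnA t' 2 2) -Et' -Exy; apply: KD.
have f0 : ev b f = 0 by rewrite Et' t0 mul0rn.
case/orP => [/nonzeroP|]; first by rewrite f0 eqxx.
(* If the pivot divides every entry, [mu] evaluates to zero and an unknown disappears. Otherwise the
   value of [mu] becomes a new unknown, and the other entries of the relation become remainders
   modulo the pivot, up to sign. *)
case/and3P => a0 /Z.eqb_eq mus; case: ifP => [/veqbP Eu|_] ck.
  have mu0 : ev b (map (fun c => Z.div c (pivot f)) (if Z.ltb Z0
      (nth Z0 f (find (fun c => Z.eqb (Z.abs c) (pivot f)) f)) then f else vopp f)) = 0.
    apply: (@lat_scaler_eq0 (pivot f)); first exact: a0.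
    by rewrite -evZ Eu; case: ifP => _; rewrite ?evN f0 ?oppr0.
  apply: (IH t _ (drop_at _ b)); first by rewrite map_drop_at; exact: ck.
  move=> z /mem_add_new[//|/mapP[w wD ->]].
  by rewrite (ev_elim _ _ mus) mu0 scaler0 subr0; apply: KD.
set mu := map _ _ in mus ck.
apply: (reduce mu _ (Zpos xH) (ev b mu) t _ mus); first by rewrite scale1r.
  by move=> z; apply.
by rewrite rho_ev.
Qed.

End Soundness.

(** * Sums of six and three lattice points *)

Definition par (x : lat) : bits :=
  (Z.odd (x 0 0), Z.odd (x 0 1), Z.odd (x 0 2%R)).

Lemma parD x y : par (x + y) = bxor (par x) (par y).
Proof.
have oddD (z t : Z) : Z.odd (z + t) = Z.odd z (+) Z.odd t.
  by rewrite (Z.odd_add z t); case: (Z.odd z); case: (Z.odd t).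
by rewrite /par /bxor /= !mxE !oddD. Qed.

Lemma par_ker x : par x = bits0 -> exists y, x = y *+ 2.
Proof.
case=> x0 x1 x2; exists (map_mx Z.div2 x); apply/rowP => i.
rewrite mulmxnE mxE mulr2n.
have {x0 x1 x2} : Z.odd (x 0 i) = false.
  by case: i => [[|[|[|//]]] lti]; [rewrite -x0|rewrite -x1|rewrite -x2];
    congr (Z.odd (x 0 _)); apply: val_inj.
move=> xi; rewrite {1}(Z.div2_odd (x 0 i)) xi /=.
by change (Z.add (Z.mul 2 (Z.div2 (x 0 i))) 0 = Z.add (Z.div2 (x 0 i)) (Z.div2 (x 0 i))); lia.
Qed.

(** In the numbering [nbits], the numbers 1, 2, 4 denote [b1], [b2], [b3], and the others denote
    sums according to their binary digits. *)
Definition comb (b1 b2 b3 e : bits) : bits :=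
  bxor (if e.2 then b1 else bits0)
    (bxor (if e.1.2 then b2 else bits0) (if e.1.1 then b3 else bits0)).

Definition indep (b1 b2 b3 : bits) : bool :=
  all (fun e => comb b1 b2 b3 e != bits0) (behead all_bits).

Lemma bxorACA : interchange bxor bxor.
Proof.
by move=> [[a1 a2] a3] [[b1 b2] b3] [[c1 c2] c3] [[d1 d2] d3];
  rewrite /bxor /= (addbACA a1) (addbACA a2) (addbACA a3).
Qed.

Lemma combD b1 b2 b3 : {morph comb b1 b2 b3 : x y / bxor x y}.
Proof.
have ifD (c d : bool) b : (if c (+) d then b else bits0) =
    bxor (if c then b else bits0) (if d then b else bits0).
  by case: c d => [] []; rewrite ?bxorxx ?bxor0 // bxorC bxor0.
by move=> x y; rewrite /comb /= !ifD [X in bxor _ X]bxorACA bxorACA.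
Qed.

(** [par] followed by the inverse of [comb] gives residues in the basis [b1], [b2], [b3], in which
    the certificate is written. *)
Lemma check_zonotope (K : lat -> Prop) (o : lat) (b : seq lat) n res D t b1 b2 b3 :
  lat_convex K -> indep b1 b2 b3 ->
  map par b = map (comb b1 b2 b3) res -> check n res D t ->
  (forall x, x \in D -> K (o + ev b x)) -> has_zonotope K.
Proof.
move=> Kc ind parb ck KD; apply: (has_zonotope_shift (o := o)).
have ker e : comb b1 b2 b3 e = bits0 -> e = bits0.
  move: ind => /allP ind /eqP; apply: contraTeq => e0; apply: ind.
  by move: (all_bitsP e); rewrite inE (negPf e0).
have inj : injective (comb b1 b2 b3).
  move=> x y E; have /ker : comb b1 b2 b3 (bxor x y) = bits0.
    by rewrite combD E bxorxx.
  by case: x y {E} => [[[] []] []] [[[] []] []].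
pose phi := invF inj; have phiK := f_invF inj; have Kphi := invF_f inj.
apply: (@check_sound (fun x => phi (par x)) _ _ _ _ n t D b) => //.
- by move=> x y; apply: (inj); rewrite combD !phiK parD.
- by move=> x /(congr1 (comb b1 b2 b3)); rewrite phiK => /par_ker.
- exact: lat_convex_shift.
- rewrite (_ : map _ b = res) //; rewrite (map_comp phi par) parb -map_comp.
  by rewrite (eq_map (g := id)) ?map_id // => e; apply: Kphi.
Qed.

Ltac case_bit x :=
  lazymatch x with
  | addb _ _ => fail
  | true => fail
  | false => fail
  | _ => case x
  end.
Ltac bits_ring :=
  rewrite /bxor /bits0; do 2?congr pair; cbn [fst snd];
  repeat match goal with
  | |- context [addb ?x ?y] => first [case_bit x | case_bit y]
  | |- ?x = ?y => first [case_bit x | case_bit y]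
  end; reflexivity.
Ltac lat_ring := let i := fresh in apply/rowP => i; rewrite ?(mxE, mulmxnE); ring.

Lemma mem_sums P Q x : x \in sums P Q ->
  exists y z, [/\ y \in P, z \in Q & x = vadd y z].
Proof. by case/mem_add_new => // /allpairsP[[y z] /= []]; exists y, z. Qed.

Lemma scaleZ0 (x : lat) : Z0 *: x = 0. Proof. exact: scale0r. Qed.
Lemma scaleZ1 (x : lat) : Zpos 1 *: x = x. Proof. exact: scale1r. Qed.
Lemma scaleZN1 (x : lat) : Zneg 1 *: x = - x. Proof. exact: scaleN1r. Qed.
Lemma scaleZN2 (x : lat) : Zneg 2 *: x = - (x *+ 2).
Proof. by rewrite (scaleNr (Zpos 2) x : Zneg 2 *: x = _) scaleZ2. Qed.

Definition evE := (scaleZ0, scaleZ1, scaleZN1, scaleZN2, add0r, addr0).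

Lemma parN x : par (- x) = par x.
Proof.
have: par (x - x) = bits0 by rewrite subrr /par !mxE.
by rewrite parD; case: (par x) (par (- x)) => [[[] []] []] [[[] []] []].
Qed.

Lemma diff_diff (a b c d : lat) : a - b = c - d -> a - c = b - d.
Proof. by move=> /(canRL (subrK _))->; lat_ring. Qed.

Lemma sum_diff (a b c d : lat) : a + b = c + d -> a - c = d - b.
Proof. by move=> /(canRL (addrK _))->; lat_ring. Qed.

Lemma bits_outside (a c : bits) : exists e, e \notin [:: bits0; a; c; bxor a c].
Proof.
have /allP/(_ _ (all_bitsP a))/allP/(_ _ (all_bitsP c))/hasP[e _ ?] :
  all (fun a => all (fun c => has (fun e => e \notin [:: bits0; a; c; bxor a c])
    all_bits) all_bits) all_bits by vm_compute.
by exists e.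
Qed.

Fixpoint holds_on (A : vec -> Prop) (s : seq vec) : Prop :=
  if s is x :: s' then A x /\ holds_on A s' else True.

Lemma holds_onP A s : holds_on A s -> forall x, x \in s -> A x.
Proof.
elim: s => //= a s IH [Aa As] x; rewrite in_cons => /orP[/eqP-> //|].
exact: IH.
Qed.

Lemma mem_plane (a c e h h' : bits) :
  let V := [:: bits0; bxor a c; bxor a e; bxor c e] in
  h \in V -> h' \in V -> bxor h h' \in V.
Proof.
cbv zeta; rewrite !inE => /or4P[] /eqP-> /or4P[] /eqP->; apply/or4P;
  first [constructor 1; apply/eqP; bits_ring | constructor 2; apply/eqP; bits_ring
       | constructor 3; apply/eqP; bits_ring | constructor 4; apply/eqP; bits_ring].
Qed.

(** * Zonotopes in the sum of [P] and [Q] *)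

Section Sumset.
Variables (P Q K : lat -> Prop).
Hypothesis Kc : lat_convex K.
Hypothesis PQK : forall x y, P x -> Q y -> K (x + y).

Lemma check_sums (po qo : lat) (b : seq lat) n res D E t b1 b2 b3 :
  indep b1 b2 b3 -> map par b = map (comb b1 b2 b3) res ->
  check n res (sums D E) t ->
  holds_on (fun x => P (po + ev b x)) D ->
  holds_on (fun y => Q (qo + ev b y)) E -> has_zonotope K.
Proof.
move=> ind parb ck /holds_onP PD /holds_onP QE.
apply: (check_zonotope (o := po + qo) Kc ind parb ck) => x /mem_sums[y [z [yD zE ->]]].
by rewrite evD addrACA; apply: PQK; [apply: PD|apply: QE].
Qed.

Lemma zonotope_parallelogram x u w y y' : P x -> P (x + u) -> P (x + w) ->
  P (x + u + w) -> Q y -> Q y' -> u != 0 -> w != 0 -> y != y' -> has_zonotope K.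
Proof.
move=> Px Pu Pw Puw Qy Qy' u0 w0 yy'; exists (x + y), u, w, (y' - y).
split=> //; first by rewrite subr_eq0 eq_sym.
move=> a c e.
have -> : x + y + u *+ a + w *+ c + (y' - y) *+ e =
    (x + u *+ a + w *+ c) + (if e then y' else y).
  rewrite -!addrA [y + _]addrC -!addrA; do 3!congr (_ + _).
  by case: e; rewrite ?mulr1n ?mulr0n ?subrK ?add0r.
apply: PQK; last by case: e.
by case: a c => [] []; rewrite ?mulr1n ?mulr0n ?addr0.
Qed.

Lemma check_tri_plane : check 100 (map nbits [:: 1; 2; 2; 3]%N) tri_sums tri_tree_plane.
Proof. by vm_compute. Qed.

Lemma check_tri_space : check 100 (map nbits [:: 1; 2; 2; 4]%N) tri_sums tri_tree_space.
Proof. by vm_compute. Qed.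

(** [b1] and [b2] span a plane; [b] is its third nonzero element or lies outside it. *)
Lemma bits_plane (b1 b2 b : bits) : b1 != bits0 -> b2 != bits0 -> b1 != b2 ->
  b != bits0 -> b != b1 -> b != b2 ->
  (exists b3, indep b1 b2 b3) /\ (b = bxor b1 b2 \/ indep b1 b2 b).
Proof.
have /allP/(_ _ (all_bitsP b1))/allP/(_ _ (all_bitsP b2))/allP/(_ _ (all_bitsP b)) :
  all (fun b1 => all (fun b2 => all (fun b =>
    [&& b1 != bits0, b2 != bits0, b1 != b2, b != bits0, b != b1 & b != b2] ==>
    has (indep b1 b2) all_bits && ((b == bxor b1 b2) || indep b1 b2 b))
    all_bits) all_bits) all_bits by vm_compute.
move=> /implyP H *; have /H/andP[/hasP[b3 _ ?] /orP[/eqP->|?]] :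
  [&& b1 != bits0, b2 != bits0, b1 != b2, b != bits0, b != b1 & b != b2].
- by apply/and5P; split=> //; apply/andP.
- by split; [exists b3|left].
- by split; [exists b3|right].
Qed.

(** Two planes of (Z/2)^3 share a nonzero element; the hypotheses rule out equality of corresponding
    elements. *)
Lemma bits_meet (u1 u2 f1 f2 : bits) :
  u1 != bits0 -> u2 != bits0 -> u1 != u2 -> f1 != bits0 -> f2 != bits0 ->
  f1 != f2 -> u1 != f1 -> u2 != f2 -> bxor u1 u2 != bxor f1 f2 ->
  [|| f1 == u2, f1 == bxor u1 u2, f2 == u1, f2 == bxor u1 u2,
      bxor f1 f2 == u1 | bxor f1 f2 == u2].
Proof.
have /allP/(_ _ (all_bitsP u1))/allP/(_ _ (all_bitsP u2))/allP/(_ _ (all_bitsP f1))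
     /allP/(_ _ (all_bitsP f2)) :
  all (fun u1 => all (fun u2 => all (fun f1 => all (fun f2 =>
  (u1 != bits0) ==> (u2 != bits0) ==> (u1 != u2) ==> (f1 != bits0) ==>
  (f2 != bits0) ==> (f1 != f2) ==> (u1 != f1) ==> (u2 != f2) ==>
  (bxor u1 u2 != bxor f1 f2) ==>
  [|| f1 == u2, f1 == bxor u1 u2, f2 == u1, f2 == bxor u1 u2,
      bxor f1 f2 == u1 | bxor f1 f2 == u2])
    all_bits) all_bits) all_bits) all_bits by vm_compute.
move=> H h1 h2 h3 h4 h5 h6 h7 h8 h9; move: H.
by rewrite h1 h2 h3 h4 h5 h6 h7 h8 h9.
Qed.

Lemma bxorA : associative bxor.
Proof. by move=> [[a b] c] [[d e] f] [[g h] i]; rewrite /bxor /= !addbA. Qed.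

Lemma bxorI : right_injective bxor.
Proof.
move=> b x y /(congr1 (bxor b)).
by rewrite !bxorA bxorxx !(bxorC bits0) !bxor0.
Qed.

Lemma bxor_eq0 x y : (bxor x y == bits0) = (x == y).
Proof. by case: x y => [[[] []] []] [[[] []] []]. Qed.

Lemma bxor_transfer a b c d : a = b -> bxor c d = bxor a b -> c == d.
Proof. by move=> ->; rewrite bxorxx -bxor_eq0 => ->. Qed.

Lemma bxor_chain y x z : bxor (bxor x y) (bxor y z) = bxor x z.
Proof.
have chain (c d e : bool) : c (+) d (+) (d (+) e) = c (+) e by case: c d e => [] [] [].
by rewrite /bxor /= !chain.
Qed.

Lemma parB x y : par (x - y) = bxor (par x) (par y).
Proof. by rewrite parD parN. Qed.

(** * Triangles of [P] congruent modulo 2 to that of [Q] *)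

Section Triangle.
(** The triangles are [p_i = a_i + b_i] and [q_i = o + a_i - b_i], so [p_i + q_i = o + 2 a_i] and
    [p_i - q_i = 2 b_i - o]. *)
Variables (a b : 'I_3 -> lat) (o : lat).
Hypothesis (Pab : forall i, P (a i + b i)) (Qab : forall i, Q (o + a i - b i)).
Hypothesis alpha : forall i j, i != j -> par (a i) != par (a j).
Hypothesis beta : forall i j, i != j -> par (b i) != par (b j).
Hypothesis alpha_beta : forall i j, i != j ->
  bxor (par (a i)) (par (a j)) != bxor (par (b i)) (par (b j)).

(** An edge of the [b]'s has the residue of a non-corresponding edge of the [a]'s. The residue of
    [f2] then lies in the plane of [u1], [u2] or outside it, with one certificate for each case. *)
Lemma triangle_zonotope_at i j k : i != j -> j != k -> i != k ->
  par (b j - b k) = par (a k - a i) -> has_zonotope K.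
Proof.
move=> ij jk ik f1.
set u1 := a j - a k; set u2 := a k - a i; rewrite -/u2 in f1.
set f2 := b k - b i.
have PD : holds_on (fun x => P (a k + b k + ev [:: u1; u2; b j - b k; f2] x))
    [:: [:: Z0; -1; Z0; -1]; [:: 1; Z0; 1; Z0]; [:: Z0; Z0; Z0; Z0]].
  rewrite /= !evE; split; last split=> //.
  - by have -> : a k + b k + (- u2 - f2) = a i + b i by rewrite /u2 /f2; lat_ring.
  - by have -> : a k + b k + (u1 + (b j - b k)) = a j + b j by rewrite /u1; lat_ring.
have QD : holds_on (fun x => Q (o + a k - b k + ev [:: u1; u2; b j - b k; f2] x))
    [:: [:: Z0; -1; Z0; 1]; [:: 1; Z0; -1; Z0]; [:: Z0; Z0; Z0; Z0]].
  rewrite /= !evE; split; last split=> //.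
  - have -> // : o + a k - b k + (- u2 + f2) = o + a i - b i by rewrite /u2 /f2; lat_ring.
  - have -> // : o + a k - b k + (u1 - (b j - b k)) = o + a j - b j.
    by rewrite /u1; lat_ring.
have u10 : par u1 != bits0 by rewrite parB bxor_eq0 alpha.
have u20 : par u2 != bits0 by rewrite parB bxor_eq0 alpha // eq_sym.
have u12 : par u1 != par u2.
  by rewrite !parB -bxor_eq0 bxor_chain bxor_eq0 alpha // eq_sym.
have f20 : par f2 != bits0 by rewrite parB bxor_eq0 beta // eq_sym.
have f2u1 : par f2 != par u1.
  move: f1; rewrite !parB => f1; apply: contra (alpha_beta ij) => /eqP f2E.
  rewrite bxorC [X in _ == X]bxorC -(bxor_chain (par (a k))) -f2E -f1.
  by rewrite [X in X == _]bxorC bxor_chain.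
have f2u2 : par f2 != par u2.
  by rewrite !parB eq_sym alpha_beta // eq_sym.
have [[b3 ind3] [f2E|ind]] := bits_plane u10 u20 u12 f20 f2u1 f2u2.
  apply: (check_sums ind3 _ check_tri_plane PD QD).
  by rewrite /= f1 f2E /comb /= !(bxorC bits0) !bxor0.
apply: (check_sums ind _ check_tri_space PD QD).
by rewrite /= f1 /comb /= !(bxorC bits0) !bxor0.
Qed.

Lemma triangle_zonotope : has_zonotope K.
Proof.
pose i0 : 'I_3 := inord 0; pose i1 : 'I_3 := inord 1; pose i2 : 'I_3 := inord 2.
have [n01 n12 n02] : [/\ i0 != i1, i1 != i2 & i0 != i2].
  by split; rewrite -val_eqE /= !inordK.
have [n10 n21 n20] : [/\ i1 != i0, i2 != i1 & i2 != i0] by split; rewrite eq_sym.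
have at_ i j k : i != j -> j != k -> i != k ->
  bxor (par (b j)) (par (b k)) == bxor (par (a k)) (par (a i)) -> has_zonotope K.
  by move=> ij jk ik /eqP E; apply: (triangle_zonotope_at ij jk ik); rewrite !parB.
(* The six possible matches of edges correspond to the six labellings of the vertices. *)
have := @bits_meet (bxor (par (a i1)) (par (a i2))) (bxor (par (a i2)) (par (a i0)))
  (bxor (par (b i1)) (par (b i2))) (bxor (par (b i2)) (par (b i0))).
rewrite !bxor_eq0 !alpha // !beta // !alpha_beta //.
have chain_eq x y z : (bxor x y == bxor y z) = (x == z).
  by rewrite -bxor_eq0 bxor_chain bxor_eq0.
rewrite !chain_eq !bxor_chain alpha // beta // alpha_beta //.
move=> /(_ isT isT isT isT isT isT isT isT isT).
case/orP => [|/orP[|/orP[|/orP[|/orP[|]]]]].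
- exact: at_.
- by rewrite [X in X == _]bxorC; apply: at_.
- by rewrite [X in X == _]bxorC [X in _ == X]bxorC; apply: at_.
- by rewrite [X in _ == X]bxorC; apply: at_.
- by rewrite [X in X == _]bxorC; apply: at_.
- by rewrite [X in _ == X]bxorC; apply: at_.
Qed.
End Triangle.

Lemma ord3_add3 (i : 'I_3) : i + 1 + 1 + 1 = i.
Proof. by case: i => [[|[|[|]]] ?] //; apply: val_inj. Qed.

Lemma ord3_neq (i j : 'I_3) : i != j -> j = i + 1 \/ j = i + 1 + 1.
Proof.
by case: i j => [[|[|[|//]]] ?] [[|[|[|//]]] ?] //= _;
  first [left; apply: val_inj; done | right; apply: val_inj; done].
Qed.

(* In the middle case [P] contains the edge [m + 1, m + 2] of [Q], reversed. *)
Lemma triangle_cases (p q : 'I_3 -> lat) :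
  (forall i, P (p i)) -> (forall i, Q (q i)) ->
  (forall i j, par (p i + q i) = par (p j + q j)) ->
  (forall i j, i != j -> par (q i) != par (q j)) ->
  [\/ has_zonotope K, exists m, p (m + 1) + q (m + 1) = p (m + 1 + 1) + q (m + 1 + 1) |
     forall i j, p i - q i = p j - q j].
Proof.
move=> Pp Qq pq qq.
have [[i [j [ij E]]]|nR] := pselect (exists i j, i != j /\ p i + q i = p j + q j).
  apply: Or32; have [jE|jE] := ord3_neq ij; rewrite {}jE in E.
    by exists (i - 1); rewrite subrK.
  by exists (i + 1); rewrite ord3_add3 -E.
set o := p ord0 + q ord0.
have /fin_all_exists[a Ea] : forall i, exists y, p i + q i - o = y *+ 2.
  by move=> i; apply: par_ker; rewrite parB (pq i ord0) bxorxx.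
pose b i := p i - a i.
have pE i : p i = a i + b i by rewrite /b addrC subrK.
have qE i : q i = o + a i - b i.
  have -> : q i = o + (p i + q i - o) - p i by rewrite [o + _]addrC subrK addrAC subrr add0r.
  by rewrite Ea mulr2n {1}pE opprD !addrA addrK.
have sumE i j : p i + q j = o + (a i + a j) + (b i - b j).
  by rewrite pE qE; lat_ring.
have KS i j : K (p i + q j) by apply: PQK.
have ab_line x y t : K x -> K y -> y = x + t *+ 4 -> t != 0 -> has_zonotope K.
  by move=> Kx Ky E t0; apply: (zonotope_line (n := 4) Kc Kx _ _ t0) => //; rewrite -E.
have [zon|nz] := pselect (has_zonotope K); first exact: Or31.
(* If [a_i] and [a_j] agree modulo 2, then [p_i + q_i] and [p_j + q_j] differ by [4 t]. For the
   [b]'s, the same holds for [p_i + q_j] and [p_j + q_i]. *)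
have alpha i j : i != j -> par (a i) != par (a j).
  move=> ij; apply/eqP => E; apply: nz.
  have [t Et] : exists t, a i - a j = t *+ 2 by apply: par_ker; rewrite parB E bxorxx.
  apply: (ab_line _ _ t (KS j j) (KS i i)).
    by rewrite !sumE !subrr !addr0 (mulrnA t 2 2) -Et; lat_ring.
  apply/eqP => t0; apply: nR; exists i, j; split=> //.
  by rewrite !sumE !subrr !addr0; move: Et; rewrite t0 mul0rn => /subr0_eq->.
have beta i j : b i != b j -> par (b i) != par (b j).
  move=> bij; apply/eqP => E; apply: nz.
  have [t Et] : exists t, b i - b j = t *+ 2 by apply: par_ker; rewrite parB E bxorxx.
  apply: (ab_line _ _ t (KS j i) (KS i j)); last first.
    by apply: contraNneq bij => t0; move: Et; rewrite t0 mul0rn => /subr0_eq->.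
  by rewrite !sumE (mulrnA t 2 2) -Et; lat_ring.
have aneq i j : i != j -> a i != a j by move/alpha; apply: contraNneq => ->.
(* Otherwise the segments from [p_k + q_i] to [p_i + q_k] and from [p_k + q_j] to [p_j + q_k] both
   have direction [2 (b_i - b_k)]. *)
have b_inj_or i j k : i != j -> b i = b j -> b k = b i.
  move=> ij bij; apply/eqP; apply: contra_notT nz => bki.
  apply: (zonotope_parallel (u := b i - b k) Kc (KS k i) _ (KS k j)).
  - by have -> : p k + q i + (b i - b k) *+ 2 = p i + q k by rewrite !sumE; lat_ring.
  - by have -> : p k + q j + (b i - b k) *+ 2 = p j + q k by rewrite !sumE bij; lat_ring.
  - apply: contra_neq (aneq i j ij) => /addrI; rewrite !qE bij.
    by move/addIr/addrI.
  - by rewrite subr_eq0 eq_sym.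
have [[i [j [ij bij]]]|nE] := pselect (exists i j, i != j /\ b i = b j).
  (* All [b_i] coincide, so [p_i - q_i = 2 b_i - o] is constant. *)
  apply: Or33 => k l; rewrite !pE !qE.
  rewrite (b_inj_or i j k ij bij) (b_inj_or i j l ij bij).
  by lat_ring.
case: nz; apply: (triangle_zonotope (a := a) (b := b) (o := o)).
- by move=> i; rewrite -pE.
- by move=> i; rewrite -qE.
- exact: alpha.
- by move=> i j ij; apply: beta; apply/eqP => bij; apply: nE; exists i, j.
- move=> i j ij; have := qq i j ij; rewrite !qE -bxor_eq0 -parB.
  rewrite (_ : _ - _ = (a i - a j) - (b i - b j)); last by lat_ring.
  by rewrite parB !parB bxor_eq0.
Qed.

(** * Two triangles in different cosets *)

Hypothesis Psep : forall x y, P x -> P y -> x != y -> par x != par y.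
Hypothesis Qsep : forall x y, Q x -> Q y -> x != y -> par x != par y.

Lemma zonotope_equal_edges x1 x2 y1 y2 z1 z2 : P x1 -> P x2 -> P y1 -> P y2 ->
  Q z1 -> Q z2 -> x1 != x2 -> x2 != y2 -> z1 != z2 -> x1 - x2 = y1 - y2 ->
  has_zonotope K.
Proof.
move=> Px1 Px2 Py1 Py2 Qz1 Qz2 x12 xy2 z12 E.
apply: (zonotope_parallelogram (x := x2) (u := x1 - x2) (w := y2 - x2) Px2 _ _ _ Qz1 Qz2) => //.
- by have -> : x2 + (x1 - x2) = x1 by lat_ring.
- by have -> : x2 + (y2 - x2) = y2 by lat_ring.
- by rewrite E; have -> : x2 + (y1 - y2) + (y2 - x2) = y1 by lat_ring.
- by rewrite subr_eq0.
- by rewrite subr_eq0 eq_sym.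
Qed.

(** The coincidences mean [p_j - p_i = q_i - q_j] and [p'_i - p'_k = q_k - q_i]. Hence
    [{p_i, p_j} + {q_i, q_k}] and [{p'_k, p'_i} + {q_j, q_i}] are translates of each other, and
    serve as opposite faces. *)
Lemma zonotope_hinge (p p' q : 'I_3 -> lat) i j k :
  (forall l, P (p l)) -> (forall l, P (p' l)) -> (forall l, Q (q l)) ->
  q i != q j -> q i != q k -> p i + q i != p' k + q j ->
  p i + q i = p j + q j -> p' i + q i = p' k + q k -> has_zonotope K.
Proof.
move=> Pp Pp' Qq qij qik neq E E'.
exists (p i + q i), (q i - q j), (q k - q i), (p' k + q j - (p i + q i)).
rewrite !subr_eq0 (eq_sym (q k)) (eq_sym (p' k + _)) qij qik neq; split=> // a c e.
have pj : p j = p i + q i - q j by rewrite E addrK.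
have pi' : p' i = p' k + q k - q i by rewrite -E' addrK.
have KS x y : K (p x + q y) by apply: PQK.
have KS' x y : K (p' x + q y) by apply: PQK.
case: a c e => [] [] []; rewrite ?mulr1n ?mulr0n ?addr0.
- have -> // : p i + q i + (q i - q j) + (q k - q i) + (p' k + q j - (p i + q i)) =
    p' k + q k by lat_ring.
- by have -> : p i + q i + (q i - q j) + (q k - q i) = p j + q k by rewrite pj; lat_ring.
- by have -> : p i + q i + (q i - q j) + (p' k + q j - (p i + q i)) = p' k + q i by lat_ring.
- by have -> : p i + q i + (q i - q j) = p j + q i by rewrite pj; lat_ring.
- have -> // : p i + q i + (q k - q i) + (p' k + q j - (p i + q i)) = p' i + q j.
  by rewrite pi'; lat_ring.
- by have -> : p i + q i + (q k - q i) = p i + q k by lat_ring.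
- by have -> : p i + q i + (p' k + q j - (p i + q i)) = p' k + q j by lat_ring.
- exact: KS.
Qed.

(** Each triangle of [P] has a reversed edge of [Q] or is a translate of its triangle. A common edge
    gives a parallelogram in [P]; two different reversed edges give a hinge. *)
Lemma two_triangles (p p' q : 'I_3 -> lat) d d' : injective q ->
  (forall i, P (p i)) -> (forall i, P (p' i)) -> (forall i, Q (q i)) ->
  (forall i, par (p i) = bxor d (par (q i))) ->
  (forall i, par (p' i) = bxor d' (par (q i))) ->
  (forall i j, bxor d d' != bxor (par (q i)) (par (q j))) -> has_zonotope K.
Proof.
move=> qI Pp Pp' Qq pd pd' dd.
have qsep i j : i != j -> par (q i) != par (q j).
  by move=> ij; apply: Qsep => //; rewrite (inj_eq qI).
have psum (r : 'I_3 -> lat) e : (forall i, par (r i) = bxor e (par (q i))) ->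
    forall i j, par (r i + q i) = par (r j + q j).
  by move=> re i j; rewrite !parD !re -!bxorA !bxorxx.
have n12 (m : 'I_3) : m + 1 != m + 1 + 1 by case: m => [[|[|[|//]]] ?].
have pp' i j : p i != p' j.
  apply: contraNneq (dd i j) => /(congr1 par); rewrite pd pd'.
  by move=> E; rewrite -bxor_eq0 bxorACA E bxorxx.
have edges m : p (m + 1) - p (m + 1 + 1) = p' (m + 1) - p' (m + 1 + 1) \/
    p (m + 1) - p (m + 1 + 1) = p' (m + 1 + 1) - p' (m + 1) -> has_zonotope K.
  have pn : p (m + 1) != p (m + 1 + 1).
    by apply: contraNneq (qsep _ _ (n12 m)) => /(congr1 par); rewrite !pd => /bxorI/eqP.
  have qn : q (m + 1) != q (m + 1 + 1) by rewrite (inj_eq qI).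
  by case; apply: zonotope_equal_edges qn.
have [//|[m E]|E] := triangle_cases Pp Qq (psum _ _ pd) qsep;
have [//|[m' E']|E'] := triangle_cases Pp' Qq (psum _ _ pd') qsep.
- have neq i j k : p i + q i != p' k + q j.
    apply: contraNneq (dd j k) => /(congr1 par); rewrite !parD pd pd'.
    rewrite -!bxorA bxorxx bxor0 => ->.
    by rewrite bxorC bxorA bxorxx bxorC bxor0 bxorC.
  have qn i j : i != j -> q i != q j by rewrite (inj_eq qI).
  have [mm'|mm'] := eqVneq m m'.
    rewrite -{}mm' in E'; apply: (edges m); left.
    by rewrite (sum_diff E) (sum_diff E').
  (* The edges opposite [m] and [m'] share the remaining vertex: [m + 2] if [m' = m + 1], and
     [m + 1] if [m' = m + 2]. *)
  have [m'E|m'E] := ord3_neq mm'; rewrite {}m'E in E' mm'.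
    rewrite ord3_add3 in E'.
    apply: (zonotope_hinge (p := p) (p' := p') (q := q) (i := m + 1 + 1) (j := m + 1) (k := m)) => //.
    + by rewrite (inj_eq qI) eq_sym.
    + by rewrite (inj_eq qI) -[X in _ != X](ord3_add3 m) n12.
  rewrite !ord3_add3 in E'.
  apply: (zonotope_hinge (p := p) (p' := p') (q := q) (i := m + 1) (j := m + 1 + 1) (k := m)) => //.
  + by rewrite (inj_eq qI).
  + by rewrite (inj_eq qI) eq_sym -(inj_eq (addIr 1)) n12.
- by apply: (edges m); right; rewrite (sum_diff E) (diff_diff (E' _ _)).
- by apply: (edges m'); right; rewrite (diff_diff (E _ _)) -(sum_diff (esym E')).
- by apply: (edges 0); left; rewrite (diff_diff (E _ _)) (diff_diff (E' _ _)).
Qed.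

(** * A translate of the three points of [Q] inside [P] *)

Lemma check_hex_in :
  let ck r := check 100 (map nbits [:: 1; 2; r; 4; 5]%N) hex_sums Stop in
  [/\ ck 0%N, ck 1%N & ck 2%N].
Proof. by split; vm_compute. Qed.

Lemma check_hex_center : check 100 (map nbits [:: 1; 2; 3; 4; 5]%N) hex_sums hex_tree_center.
Proof. by vm_compute. Qed.

(** With first unknowns [v], [w] and [r] outside their plane, the last two points have residues [r],
    [r + v] here, and [r + w], [r + v + w] in [check_hex_far]. *)
Lemma check_hex_near : check 100 (map nbits [:: 1; 2; 4; 4; 5]%N) hex_sums hex_tree_near.
Proof. by vm_compute. Qed.

Lemma check_hex_far : check 100 (map nbits [:: 1; 2; 4; 6; 7]%N) hex_sums hex_tree_far.
Proof. by vm_compute. Qed.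

(** The plane of [v], [w] has only two cosets: if [r] is not in the plane, it lies in the coset of
    [y]. *)
Lemma bits_hex (v w r y : bits) : v != bits0 -> w != bits0 -> v != w ->
  y \notin [:: bits0; v; w; bxor v w] ->
  indep v w y && (r \in [:: bits0; v; w; bxor v w]) ||
  indep v w r && (y \in [:: r; bxor r v; bxor r w; bxor r (bxor v w)]).
Proof.
have /allP/(_ _ (all_bitsP v))/allP/(_ _ (all_bitsP w))/allP/(_ _ (all_bitsP r))
     /allP/(_ _ (all_bitsP y)) :
  all (fun v => all (fun w => all (fun r => all (fun y =>
  (v != bits0) ==> (w != bits0) ==> (v != w) ==>
  (y \notin [:: bits0; v; w; bxor v w]) ==>
  (indep v w y && (r \in [:: bits0; v; w; bxor v w]) ||
   indep v w r && (y \in [:: r; bxor r v; bxor r w; bxor r (bxor v w)])))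
    all_bits) all_bits) all_bits) all_bits by vm_compute.
by move=> H h1 h2 h3 h4; move: H; rewrite h1 h2 h3 h4.
Qed.

(** [x] has the fourth residue in the coset of the translated triangle; [y] and [z] lie in the other
    coset and differ modulo 2 like [q_i] and [q_j]. *)
Lemma extended_triangle (q : 'I_3 -> lat) s x y z i j k :
  injective q -> i != j -> j != k -> i != k -> (forall l, Q (q l)) ->
  (forall l, P (s + q l)) -> P x -> P y -> P z ->
  par x = bxor (par s) (bxor (par (q i)) (bxor (par (q j)) (par (q k)))) ->
  par z = bxor (par y) (bxor (par (q i)) (par (q j))) ->
  (forall l, par y != bxor (par s) (par (q l))) -> par y != par x ->
  has_zonotope K.
Proof.
move=> qI ij jk ik Qq Psq Px Py Pz xE zE yq yx.
have qsep a b : a != b -> par (q a) != par (q b).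
  by move=> ab; apply: Qsep => //; rewrite (inj_eq qI).
set po := s + q i; set v := q j - q i; set w := q k - q i.
(* This writes [x] as [po + v + w - 2 r], the fourth point in [hex_sums]. *)
have [r Er] : exists r, v + w - (x - po) = r *+ 2.
  by apply: par_ker; rewrite parB parD [par (x - po)]parB xE /po parD /v /w !parB; bits_ring.
have fin rs t b3 y' z' : P y' -> P z' -> indep (par v) (par w) b3 ->
    map par [:: v; w; r; y' - po; z' - po] = map (comb (par v) (par w) b3) rs ->
    check 100 rs hex_sums t -> has_zonotope K.
  move=> Py' Pz' ind E ck.
  apply: (check_sums (po := po) (qo := q i) ind E ck) => {ck}.
    rewrite /= !evE; split; last split; last split; last split; last split; last split=> //.
    - exact: Psq.
    - by have -> : po + v = s + q j by rewrite /po /v; lat_ring.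
    - by have -> : po + w = s + q k by rewrite /po /w; lat_ring.
    - by have -> : po + (v + (w - r *+ 2)) = x by rewrite -Er; lat_ring.
    - by have -> : po + (y' - po) = y' by lat_ring.
    - by have -> : po + (z' - po) = z' by lat_ring.
  rewrite /= !evE; split=> //; split; last split=> //.
  - by have -> : q i + v = q j by rewrite /v; lat_ring.
  - by have -> : q i + w = q k by rewrite /w; lat_ring.
have v0 : par v != bits0 by rewrite parB bxor_eq0 qsep // eq_sym.
have w0 : par w != bits0 by rewrite parB bxor_eq0 qsep // eq_sym.
have vw : par v != par w.
  by rewrite !parB [X in _ != X]bxorC -bxor_eq0 bxor_chain bxor_eq0 qsep.
have zy : par (z - po) = bxor (par (y - po)) (par v).
  by rewrite /v !parB zE; bits_ring.
have y0 : par (y - po) \notin [:: bits0; par v; par w; bxor (par v) (par w)].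
  have yE : par (y - po) = bxor (par y) (bxor (par s) (par (q i))) by rewrite parB parD.
  rewrite !inE !negb_or yE; apply/and4P; split.
  - by apply: contra (yq i) => /eqP/bxor_transfer; apply; bits_ring.
  - apply: contra (yq j) => /eqP/bxor_transfer; apply.
    by rewrite /v !parB; bits_ring.
  - apply: contra (yq k) => /eqP/bxor_transfer; apply.
    by rewrite /w !parB; bits_ring.
  - apply: contra yx => /eqP/bxor_transfer; apply.
    by rewrite xE /v /w !parB; bits_ring.
have E1 b3 : comb (par v) (par w) b3 (nbits 1) = par v by rewrite /comb /= !bxor0.
have E2 b3 : comb (par v) (par w) b3 (nbits 2) = par w.
  by rewrite /comb /= bxorC !bxor0.
have E3 b3 : comb (par v) (par w) b3 (nbits 3) = bxor (par v) (par w).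
  by rewrite /comb /= !bxor0.
have E4 b3 : comb (par v) (par w) b3 (nbits 4) = b3.
  by rewrite /comb /= ![bxor bits0 _]bxorC !bxor0.
have E5 b3 : comb (par v) (par w) b3 (nbits 5) = bxor b3 (par v).
  by rewrite /comb /= ![bxor bits0 _]bxorC !bxor0 bxorC.
have E6 b3 : comb (par v) (par w) b3 (nbits 6) = bxor b3 (par w).
  by rewrite /comb /= ![bxor bits0 _]bxorC !bxor0 bxorC.
have E7 b3 : comb (par v) (par w) b3 (nbits 7) = bxor b3 (bxor (par v) (par w)).
  by rewrite /comb /= bxorA bxorC.
have E0 b3 : comb (par v) (par w) b3 (nbits 0) = bits0 by [].
case/orP: (bits_hex (par r) v0 w0 vw y0) => /andP[ind].
  have [ck0 ck1 ck2] := check_hex_in; rewrite !inE => /or4P[] /eqP rE.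
  - apply: (fin _ _ _ y z Py Pz ind _ ck0).
    by rewrite /= zy rE E1 E2 E0 E4 E5.
  - apply: (fin _ _ _ y z Py Pz ind _ ck1).
    by rewrite /= zy rE E1 E2 E4 E5.
  - apply: (fin _ _ _ y z Py Pz ind _ ck2).
    by rewrite /= zy rE E1 E2 E4 E5.
  - apply: (fin _ _ _ y z Py Pz ind _ check_hex_center).
    by rewrite /= zy rE E1 E2 E3 E4 E5.
(* As [z - y] is congruent to [v], exchanging [y] and [z] reduces four positions to two. *)
rewrite !inE => /or4P[] /eqP yE.
- apply: (fin _ _ _ y z Py Pz ind _ check_hex_near).
  by rewrite /= zy yE E1 E2 E4 E5.
- apply: (fin _ _ _ z y Pz Py ind _ check_hex_near).
  by rewrite /= zy yE E1 E2 E4 E5 -bxorA bxorxx bxor0.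
- apply: (fin _ _ _ y z Py Pz ind _ check_hex_far).
  by rewrite /= zy yE E1 E2 E4 E6 E7 -bxorA (bxorC (par w)).
- apply: (fin _ _ _ z y Pz Py ind _ check_hex_far).
  rewrite /= zy yE E1 E2 E4 E6 E7; congr [:: _; _; _; _; _].
  by bits_ring.
Qed.

Lemma ord3_cases (i j k l : 'I_3) : i != j -> j != k -> i != k ->
  [\/ l = i, l = j | l = k].
Proof.
move=> ij jk ik; have [li|li] := eqVneq l i; first exact: Or31.
have [lj|lj] := eqVneq l j; first exact: Or32.
have [lk|lk] := eqVneq l k; first exact: Or33.
have : uniq [:: l; i; j; k] by rewrite /= !inE !negb_or li lj lk ij ik jk.
by move/card_uniqP => /= c4; have := max_card (mem [:: l; i; j; k]); rewrite c4 card_ord.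
Qed.

(* Among more than three triangles two have the same reversed edge of [Q], which gives a
   parallelogram in [P]. *)
Lemma many_triangles (I : finType) (T : I -> 'I_3 -> lat) (d : I -> bits)
    (q : 'I_3 -> lat) : (3 < #|I|)%N -> injective q -> injective d ->
  (forall t l, P (T t l)) -> (forall l, Q (q l)) ->
  (forall t l, par (T t l) = bxor (d t) (par (q l))) ->
  has_zonotope K \/ exists t, forall i j, T t i - q i = T t j - q j.
Proof.
move=> I3 qI dI PT Qq dT.
have qsep i j : i != j -> par (q i) != par (q j).
  by move=> ij; apply: Qsep => //; rewrite (inj_eq qI).
have [zon|nz] := pselect (has_zonotope K); [by left|right].
apply: contrapT => nE.
have /choice[m Em] : forall t, exists m,
    T t (m + 1) + q (m + 1) = T t (m + 1 + 1) + q (m + 1 + 1).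
  move=> t; have sumE i j : par (T t i + q i) = par (T t j + q j).
    by rewrite !parD !dT -!bxorA !bxorxx.
  by case: (triangle_cases (PT t) Qq sumE qsep) => // E; case: nE; exists t.
have : ~~ injectiveb m.
  apply: contraL I3 => /injectiveP mI; rewrite -leqNgt.
  by rewrite -[3%N]card_ord; apply: leq_card mI.
case/injectivePn => t [t' tt' mm']; apply: nz.
have n12 : m t + 1 != m t + 1 + 1 by case: (m t) => [[|[|[|//]]] ?].
apply: (zonotope_equal_edges (x1 := T t (m t + 1)) (x2 := T t (m t + 1 + 1))
  (y1 := T t' (m t + 1)) (y2 := T t' (m t + 1 + 1)) _ _ _ _
  (Qq (m t + 1)) (Qq (m t + 1 + 1))) => //.
- by apply: contraNneq (qsep _ _ n12) => /(congr1 par); rewrite !dT => /bxorI/eqP.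
- apply: contra_neq tt' => /(congr1 par); rewrite !dT !(bxorC _ (par (q _))).
  by move=> /bxorI/dI.
- by rewrite (inj_eq qI).
- by rewrite (sum_diff (Em t)) mm' (sum_diff (Em t')).
Qed.

(** * The two residues missed by six points *)

Lemma six_residues (p : 'I_6 -> lat) : (forall i, P (p i)) -> injective p ->
  exists m1 m2, m1 != m2 /\ exists pt : bits -> lat, forall e,
    e != m1 -> e != m2 -> P (pt e) /\ par (pt e) = e.
Proof.
move=> Pp pI; have rI : injective (par \o p).
  by move=> i j; apply: contra_eq => ij; apply: Psep => //; rewrite (inj_eq pI).
have : #|~: [set par (p i) | i : 'I_6]| = 2%N.
  apply/eqP; rewrite -(eqn_add2l #|[set par (p i) | i : 'I_6]|) cardsC.
  by rewrite (card_imset _ rI) card_ord !card_prod card_bool.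
move/eqP/cards2P => [m1 [m2 [m12 E]]]; exists m1, m2; split=> //.
have /choice[pt Ept] : forall e, exists x, e != m1 -> e != m2 -> P x /\ par x = e.
  move=> e; have [->|e1] := eqVneq e m1; first by exists 0.
  have [->|e2] := eqVneq e m2; first by exists 0.
  have : e \notin ~: [set par (p i) | i : 'I_6] by rewrite E !inE negb_or e1 e2.
  by rewrite inE negbK => /imsetP[i _ ->]; exists (p i).
by exists pt.
Qed.

Lemma lattice_zonotope_sep (p : 'I_6 -> lat) (q : 'I_3 -> lat) :
  injective p -> injective q -> (forall i, P (p i)) -> (forall i, Q (q i)) ->
  has_zonotope K.
Proof.
move=> pI qI Pp Qq; have [m1 [m2 [m12 [pt ptP]]]] := six_residues Pp pI.
have qsep i j : i != j -> par (q i) != par (q j).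
  by move=> ij; apply: Qsep => //; rewrite (inj_eq qI).
pose b i := par (q i).
have [[i [j Eij]]|nH] := pselect (exists i j, bxor m1 m2 = bxor (b i) (b j)); last first.
  have H i j : bxor m1 m2 != bxor (b i) (b j).
    by apply/eqP => E; apply: nH; exists i, j.
  have [i [j [k [ij jk ik]]]] : exists i j k : 'I_3, [/\ i != j, j != k & i != k].
    by exists (inord 0), (inord 1), (inord 2); split; rewrite -val_eqE /= !inordK.
  (* [sg + b_l] is the sum of the other two [b]'s, so the [m1 + sg + b_l] are the residues other
     than [m1] in its coset; likewise for [m2]. *)
  pose sg := bxor (b i) (bxor (b j) (b k)).
  have sgE l : exists x y, x != y /\ bxor sg (b l) = bxor (b x) (b y).
    by have [-> | -> | ->] := ord3_cases l ij jk ik;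
      [exists j, k|exists i, k|exists i, j]; split=> //; rewrite /sg /b; bits_ring.
  have av1 l : P (pt (bxor m1 (bxor sg (b l)))) /\
      par (pt (bxor m1 (bxor sg (b l)))) = bxor m1 (bxor sg (b l)).
    have [x [y [xy ->]]] := sgE l; apply: ptP.
      by apply: contra (qsep _ _ xy) => /eqP/bxor_transfer; apply; rewrite /b; bits_ring.
    by apply: contra (H x y) => /eqP/bxor_transfer; apply; bits_ring.
  have av2 l : P (pt (bxor m2 (bxor sg (b l)))) /\
      par (pt (bxor m2 (bxor sg (b l)))) = bxor m2 (bxor sg (b l)).
    have [x [y [xy ->]]] := sgE l; apply: ptP.
      by apply: contra (H x y) => /eqP/bxor_transfer; apply; bits_ring.
    by apply: contra (qsep _ _ xy) => /eqP/bxor_transfer; apply; rewrite /b; bits_ring.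
  apply: (two_triangles (p := fun l => pt (bxor m1 (bxor sg (b l))))
    (p' := fun l => pt (bxor m2 (bxor sg (b l)))) (d := bxor m1 sg) (d' := bxor m2 sg)
    qI) => //.
  - by move=> l; case: (av1 l).
  - by move=> l; case: (av2 l).
  - by move=> l; rewrite -bxorA; case: (av1 l).
  - by move=> l; rewrite -bxorA; case: (av2 l).
  - by move=> x y; rewrite bxorACA bxorxx bxor0; apply: H.
have ij : i != j.
  by apply: contraNneq m12 => ij; rewrite -bxor_eq0 Eij ij bxorxx.
have [k jk ik] : exists2 k, j != k & i != k.
  have succ (l : 'I_3) : [&& l + 1 != l, l + 1 + 1 != l & l + 1 != l + 1 + 1].
    by case: l => [[|[|[|//]]] ?].
  have /and3P[s1 s2 s3] := succ i.
  have [->|->] := ord3_neq ij; [exists (i + 1 + 1)|exists (i + 1)] => //.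
  - by rewrite eq_sym.
  - by rewrite eq_sym.
  - by rewrite eq_sym.
have [bij bjk bik] : [/\ b i != b j, b j != b k & b i != b k] by split; apply: qsep.
(* Now [m1] and [m2] share a coset of the plane [V]. With [e] outside [V], the coset of [m1 + e] is
   filled by [P]. *)
have [e eV] := bits_outside (bxor (b i) (b j)) (bxor (b i) (b k)).
pose V := [:: bits0; bxor (b i) (b j); bxor (b i) (b k); bxor (b j) (b k)].
have {eV} offV h : h \in V -> e != h.
  apply: contraTneq => <-; rewrite /V.
  by rewrite -[bxor (b j) _](bxor_chain (b i)) [bxor (b j) (b i)]bxorC.
have Vclosed h h' : h \in V -> h' \in V -> bxor h h' \in V by apply: mem_plane.
have [Vij [Vik Vjk]] : bxor (b i) (b j) \in V /\ bxor (b i) (b k) \in V /\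
    bxor (b j) (b k) \in V by rewrite !inE !eqxx !orbT.
have Vii m m' : bxor (b m) (b m') \in V.
  have [-> | -> | ->] := ord3_cases m ij jk ik;
  have [-> | -> | ->] := ord3_cases m' ij jk ik; rewrite ?bxorxx ?mem_head //; by rewrite bxorC.
pose sg := bxor (b i) (bxor (b j) (b k)).
have Vsg m : bxor sg (b m) \in V.
  have -> : bxor sg (b m) = bxor (bxor (b i) (b m)) (bxor (b j) (b k)).
    by rewrite /sg; bits_ring.
  exact: Vclosed.
(* The four triangles of the full coset: triangle [t] has the residues [d t + b_l] and omits
   [d t + sg]. *)
pose d (t : option 'I_3) := bxor (bxor m1 (bxor e (b i)))
  (if t is Some m then bxor sg (b m) else bits0).
have dV t : exists2 h, h \in V & d t = bxor m1 (bxor e (bxor h (b i))).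
  case: t => [m|]; [exists (bxor sg (b m)) => //|exists bits0; first exact: mem_head].
    by rewrite /d; bits_ring.
  by rewrite /d; bits_ring.
have dH t l : exists2 h, h \in V & bxor (d t) (b l) = bxor m1 (bxor e h).
  have [h hV ->] := dV t; exists (bxor h (bxor (b i) (b l))); first exact: Vclosed.
  by bits_ring.
have dsgH t : exists2 h, h \in V & bxor (d t) sg = bxor m1 (bxor e h).
  have [h hV ->] := dV t; exists (bxor h (bxor (b j) (b k))); first exact: Vclosed.
  by rewrite /sg; bits_ring.
have eH h : h \in V ->
    P (pt (bxor m1 (bxor e h))) /\ par (pt (bxor m1 (bxor e h))) = bxor m1 (bxor e h).
  move=> hV; apply: ptP.
    by apply: contra (offV _ hV) => /eqP/bxor_transfer; apply; bits_ring.
  apply: contra (offV _ (Vclosed _ _ hV Vij)) => /eqP/bxor_transfer; apply.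
  by rewrite -Eij; bits_ring.
have TP t l : P (pt (bxor (d t) (b l))) /\ par (pt (bxor (d t) (b l))) = bxor (d t) (b l).
  by have [h hH ->] := dH t l; apply: eH.
(* The next two points have the two residues other than [m1] and [m2] in their coset. *)
have yP : P (pt (bxor m1 (bxor (b j) (b k)))) /\
    par (pt (bxor m1 (bxor (b j) (b k)))) = bxor m1 (bxor (b j) (b k)).
  apply: ptP.
    by apply: contra bjk => /eqP/bxor_transfer; apply; bits_ring.
  apply: contra bik => /eqP/bxor_transfer; apply.
  by rewrite -(bxor_chain (b j)) -Eij; bits_ring.
have zP : P (pt (bxor m1 (bxor (b i) (b k)))) /\
    par (pt (bxor m1 (bxor (b i) (b k)))) = bxor m1 (bxor (b i) (b k)).
  apply: ptP.
    by apply: contra bik => /eqP/bxor_transfer; apply; bits_ring.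
  apply: contra bjk => /eqP/bxor_transfer; apply.
  by rewrite -(bxor_chain (b i)) [bxor (b j) _]bxorC -Eij; bits_ring.
have sgn m : bxor sg (b m) != bits0.
  have [-> | -> | ->] := ord3_cases m ij jk ik.
  - by apply: contra bjk => /eqP/bxor_transfer; apply; rewrite /sg; bits_ring.
  - by apply: contra bik => /eqP/bxor_transfer; apply; rewrite /sg; bits_ring.
  - by apply: contra bij => /eqP/bxor_transfer; apply; rewrite /sg; bits_ring.
have dI : injective d.
  move=> [m|] [m'|] // /bxorI E.
  - by congr Some; apply: contra_eq (bxorI E) => /qsep.
  - by have := sgn m; rewrite E eqxx.
  - by have := sgn m'; rewrite -E eqxx.
have I4 : (3 < #|{: option 'I_3}|)%N by rewrite card_option card_ord.
have [//|[t Et]] := many_triangles (T := fun t l => pt (bxor (d t) (b l))) I4 qI dI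
  (fun t l => (TP t l).1) Qq (fun t l => (TP t l).2).
pose s := pt (bxor (d t) (b i)) - q i.
have ps : par s = d t by rewrite parB (TP t i).2 -bxorA bxorxx bxor0.
have [xP xE] : P (pt (bxor (d t) sg)) /\ par (pt (bxor (d t) sg)) = bxor (d t) sg.
  by have [h hH ->] := dsgH t; apply: eH.
apply: (extended_triangle (q := q) (s := s) (i := i) (j := j) (k := k) qI ij jk ik Qq
   _ xP yP.1 zP.1).
- by move=> l; rewrite /s (Et i l) subrK; exact: (TP t l).1.
- by rewrite xE ps.
- by rewrite yP.2 zP.2 /b; bits_ring.
- move=> l; rewrite yP.2 ps; have [h hV ->] := dH t l.
  by apply: contra (offV _ (Vclosed _ _ hV Vjk)) => /eqP/bxor_transfer; apply; bits_ring.
- rewrite yP.2 xE; have [h hV ->] := dsgH t.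
  by apply: contra (offV _ (Vclosed _ _ hV Vjk)) => /eqP/bxor_transfer; apply; bits_ring.
Qed.

End Sumset.

(** Two congruent points of [P], added to two points of [Q], give parallel segments with direction
    [2 t], and symmetrically. So residues may be assumed distinct. *)
Lemma lattice_zonotope (K : lat -> Prop) (p : 'I_6 -> lat) (q : 'I_3 -> lat) :
  lat_convex K -> injective p -> injective q ->
  (forall i j, K (p i + q j)) -> has_zonotope K.
Proof.
move=> Kc pI qI Kpq.
pose P x := exists i, x = p i; pose Q y := exists j, y = q j.
have PQK x y : P x -> Q y -> K (x + y) by move=> [i ->] [j ->].
have Pp i : P (p i) by exists i.
have Qq i : Q (q i) by exists i.
have [//|nz] := pselect (has_zonotope K).
have half x y : par x = par y -> exists t, y = x + t *+ 2.
  move=> E; have [t Et] : exists t, y - x = t *+ 2 by apply: par_ker; rewrite parB E bxorxx.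
  by exists t; rewrite -Et addrC subrK.
have Psep x y : P x -> P y -> x != y -> par x != par y.
  move=> Px Py xy; apply: contra_notN nz => /eqP/half[t Et].
  apply: (zonotope_parallel (x := x + q 0) (y := x + q 1) (u := t) Kc).
  - exact: PQK.
  - by rewrite addrAC -Et; apply: PQK.
  - exact: PQK.
  - by rewrite addrAC -Et; apply: PQK.
  - by rewrite (inj_eq (addrI x)) (inj_eq qI).
  - by apply: contraNneq xy => t0; rewrite Et t0 mul0rn addr0.
have Qsep x y : Q x -> Q y -> x != y -> par x != par y.
  move=> Qx Qy xy; apply: contra_notN nz => /eqP/half[t Et].
  apply: (zonotope_parallel (x := p 0 + x) (y := p 1 + x) (u := t) Kc).
  - exact: PQK.
  - by rewrite -addrA -Et; apply: PQK.
  - exact: PQK.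
  - by rewrite -addrA -Et; apply: PQK.
  - by rewrite (inj_eq (addIr x)) (inj_eq pI).
  - by apply: contraNneq xy => t0; rewrite Et t0 mul0rn addr0.
exact: (lattice_zonotope_sep Kc PQK Psep Qsep pI qI Pp Qq).
Qed.

(** * Real polytopes *)

Local Open Scope classical_set_scope.

Section RealPoints.
Variable R : realType.
Notation pt := 'rV[R]_3.

Lemma convex_setP n (A : set 'rV[R]_n) : convex_set A <->
  forall x y (t : R), 0 <= t <= 1 -> A x -> A y -> A (t *: x + (1 - t) *: y).
Proof.
split=> [Ac x y t /andP[t0 t1] Ax Ay|Ac x y l].
  by have := Ac x y (Itv01 t0 t1); rewrite !inE; apply.
by rewrite !inE => Ax Ay; apply: Ac => //; apply/andP; split.
Qed.

Lemma conv_hull_convex n (V : set 'rV[R]_n) : convex_set (conv_hull V).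
Proof.
apply/convex_setP => x y t t01 Hx Hy A [Ac VA]; move/convex_setP: (Ac); apply=> //.
  by apply: Hx; split.
by apply: Hy; split.
Qed.

Lemma mink_sum_convex n (A B : set 'rV[R]_n) :
  convex_set A -> convex_set B -> convex_set (mink_sum A B).
Proof.
move=> /convex_setP Ac /convex_setP Bc; apply/convex_setP.
move=> _ _ t t01 [a Aa [b Bb <-]] [a' Aa' [b' Bb' <-]].
exists (t *: a + (1 - t) *: a'); first exact: Ac.
exists (t *: b + (1 - t) *: b'); first exact: Bc.
by rewrite !scalerDr addrACA.
Qed.

Lemma convex_shift n (A : set 'rV[R]_n) (s : 'rV[R]_n) :
  convex_set A -> convex_set [set x | A (x + s)].
Proof.
move=> /convex_setP Ac; apply/convex_setP => x y t t01 /= Ax Ay.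
have -> : t *: x + (1 - t) *: y + s = t *: (x + s) + (1 - t) *: (y + s).
  by rewrite !scalerDr addrACA -(scalerDl s) (addrC t) subrK scale1r.
exact: Ac.
Qed.

(** * The integer lattice inside real space *)

Definition zreal (z : Z) : R := (int_of_Z z)%:~R.

Lemma zrealD x y : zreal (x + y) = zreal x + zreal y.
Proof. by rewrite /zreal rmorphD intrD. Qed.

Lemma zreal_inj : injective zreal.
Proof. by move=> x y /intr_inj/(can_inj int_of_ZK). Qed.

Definition realize (x : lat) : pt := map_mx zreal x.

Lemma realizeD x y : realize (x + y) = realize x + realize y.
Proof. by apply/rowP => i; rewrite !mxE zrealD. Qed.

Lemma realize_inj : injective realize.
Proof. by move=> x y /rowP E; apply/rowP => i; apply: zreal_inj; have := E i; rewrite !mxE. Qed.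

Lemma realize0 : realize 0 = 0.
Proof. by apply: (addrI (realize 0)); rewrite -realizeD !addr0. Qed.

Lemma realizeMn x n : realize (x *+ n) = n%:R *: realize x.
Proof.
elim: n => [|n IH]; first by rewrite mulr0n realize0 scale0r.
by rewrite mulrS realizeD IH -natr1 scalerDl scale1r addrC.
Qed.

Lemma lattice_pts_realize (x : pt) : @lattice_pts R 3 x -> exists z, x = realize z.
Proof.
move=> /mxOverP xint; have /fin_all_exists[z Ez] : forall j, exists z, x 0 j = zreal z.
  move=> j; have /intrP[m ->] := xint 0 j.
  by exists (Z_of_int m); rewrite /zreal Z_of_intK.
by exists (\row_j z j); apply/rowP => j; rewrite !mxE Ez.
Qed.

Lemma realize_lattice_pts x : @lattice_pts R 3 (realize x).
Proof. by apply/mxOverP => i j; rewrite mxE /zreal intr_int. Qed.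

Lemma realize_convex (A : set pt) : convex_set A -> lat_convex (fun x => A (realize x)).
Proof.
move=> /convex_setP Ac a c e x y z w Ax Ay Az n0.
move/(congr1 realize); rewrite !realizeD !realizeMn.
set n := (a + c + e)%N in n0 *; have nR : n%:R != 0 :> R by rewrite pnatr_eq0 -lt0n.
move=> /(congr1 (fun v => n%:R^-1 *: v)); rewrite scalerA mulVf // scale1r => ->.
(* The combination is nested: first [x] with [y], then with [z]. The inner weights have denominator
   [a + c], so its vanishing is treated apart. *)
have [ac0|ac0] := posnP (a + c)%N.
  have [a0 c0] : a = 0%N /\ c = 0%N by move: ac0; lia.
  rewrite a0 c0 !scale0r !add0r scalerA (_ : e = n) ?mulVf ?scale1r //.
  by rewrite /n a0 c0.
have mR : (a + c)%:R != 0 :> R by rewrite pnatr_eq0 -lt0n.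
have nE : n%:R = (a + c)%:R + e%:R :> R by rewrite -natrD.
have -> : n%:R^-1 *: (a%:R *: realize x + c%:R *: realize y + e%:R *: realize z) =
    ((a + c)%:R / n%:R) *: ((a%:R / (a + c)%:R) *: realize x +
      (1 - a%:R / (a + c)%:R) *: realize y) + (1 - (a + c)%:R / n%:R) *: realize z.
  rewrite !scalerDr !scalerA; congr (_ *: _ + _ *: _ + _ *: _).
  - by field; rewrite -?natrD nR mR.
  - by field; rewrite -?natrD nR mR.
  - by rewrite nE; field; rewrite -?natrD nR.
apply: (Ac) => //; last apply: (Ac) => //.
  by rewrite divr_ge0 ?ler0n //= ler_pdivrMr ?ltr0n // mul1r ler_nat leq_addr.
by rewrite divr_ge0 ?ler0n //= ler_pdivrMr ?ltr0n // mul1r ler_nat leq_addr.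
Qed.

(** * Convex hulls and sums of segments *)

Lemma conv_hull_sub n (V A : set 'rV[R]_n) :
  convex_set A -> V `<=` A -> conv_hull V `<=` A.
Proof. by move=> Ac VA x; apply; split. Qed.

Lemma conv_hull_shift n (A V : set 'rV[R]_n) (s x : 'rV[R]_n) : convex_set A ->
  (forall v, V v -> A (v + s)) -> conv_hull V x -> A (x + s).
Proof.
move=> Ac VA; apply: (@conv_hull_sub _ V [set x | A (x + s)]) => //.
exact: convex_shift.
Qed.

Lemma sub_conv_hull n (V : set 'rV[R]_n) : V `<=` conv_hull V.
Proof. by move=> v Vv A [_]; apply. Qed.

Lemma aff_dim_gt0 (A : set pt) (x y : pt) : A x -> A y -> x != y ->
  (0 < aff_dim A)%N.
Proof.
move=> Ax Ay xy; apply: leq_trans (leq_bigmax_cond (Ordinal (isT : 1 < 4)%N) _) => //.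
apply/asboolP; exists x, (y - x); split=> //.
  by move=> i; rewrite row_id addrC subrK.
by rewrite -row_leq_rank rank_rV subr_eq0 eq_sym xy.
Qed.

(** The summands are the segments from [z] to [z + u], from [0] to [v] and from [0] to [w]. By
    convexity each can be replaced by its endpoints, one at a time. *)
Lemma zonotope_contains_mink_sum (A : set pt) : convex_set A ->
  has_zonotope (fun x => A (realize x)) -> contains_mink_sum A 3.
Proof.
move=> Ac [z [u [v [w [u0 v0 w0 Az]]]]].
pose F : seq (lat * lat) := [:: (z, z + u); (0, v); (0, w)].
pose V (i : nat) : set pt := [set realize (nth (0, 0) F i).1; realize (nth (0, 0) F i).2].
exists (fun i => conv_hull (V i)); split=> [i|].
  split.
    exists (V i) => //; split; first exact: finite_set2.
    by move=> _ [] ->; apply: realize_lattice_pts.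
  apply: (aff_dim_gt0 (x := realize (nth (0, 0) F i).1) (y := realize (nth (0, 0) F i).2)).
  - by apply: sub_conv_hull; left.
  - by apply: sub_conv_hull; right.
  rewrite (inj_eq realize_inj) eq_sym.
  case: i => [[|[|[|//]]] lti] //=.
  by rewrite -subr_eq0 addrAC subrr add0r.
rewrite !big_ord_recl big_ord0 /=.
move=> _ [a Va [_ [b Vb [_ [c Vc [_ -> <-]]] <-] <-]].
rewrite addr0; apply: (conv_hull_shift Ac _ Va) => a' Va'.
rewrite addrCA; apply: (conv_hull_shift Ac _ Vb) => b' Vb'.
rewrite addrA addrC; apply: (conv_hull_shift Ac _ Vc) => c' Vc'.
have [ea ->] : exists e : bool, a' = realize (z + u *+ e).
  by case: Va' => ->; [exists false; rewrite mulr0n addr0|exists true].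
have [eb ->] : exists e : bool, b' = realize (v *+ e).
  by case: Vb' => ->; [exists false|exists true].
have [ec ->] : exists e : bool, c' = realize (w *+ e).
  by case: Vc' => ->; [exists false|exists true].
by rewrite -!realizeD addrC (addrC (v *+ eb)).
Qed.

(** * Boundedness and the Minkowski length *)

Lemma conv_hull_bounded (V : set pt) : finite_set V ->
  exists B : R, forall x, conv_hull V x -> forall i, `|x 0 i| <= B.
Proof.
move=> /finite_seqP[s ->]; pose B := \sum_(v <- s) \sum_j `|(v : pt) 0 j|.
exists B => x; apply: (@conv_hull_sub _ _ [set x | forall i, `|x 0 i| <= B]).
  apply/convex_setP => y z t /andP[t0 t1] /= Hy Hz i; rewrite !mxE.
  apply: le_trans (ler_normD _ _) _; have t1' : 0 <= 1 - t by rewrite subr_ge0.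
  rewrite !normrM (ger0_norm t0) (ger0_norm t1').
  have -> : B = t * B + (1 - t) * B by ring.
  by rewrite lerD // ler_wpM2l.
move=> v /= vs i; rewrite /B (big_rem v) //= (bigD1 i) //= -addrA lerDl.
by rewrite addr_ge0 // sumr_ge0 // => w _; rewrite ?sumr_ge0.
Qed.

(** A hull of at most one generator has at most one point, which leaves no nonzero row for [M]. *)
Lemma lattice_polytope_two_points (A : set pt) : lattice_polytope A ->
  (0 < aff_dim A)%N -> exists x y : lat, [/\ x != y, A (realize x) & A (realize y)].
Proof.
move=> [V [_ Vlat] ->] dimA; apply: contrapT => none.
have one v v' : V v -> V v' -> v = v'.
  move=> Vv Vv'; apply/eqP; apply: contra_notT none => vv'.
  have [x Ex] := lattice_pts_realize (Vlat _ Vv).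
  have [y Ey] := lattice_pts_realize (Vlat _ Vv').
  exists x, y; split; first by apply: contraNneq vv' => xy; rewrite Ex Ey xy.
    by rewrite -Ex; apply: sub_conv_hull.
  by rewrite -Ey; apply: sub_conv_hull.
have sub1 v : V v -> conv_hull V `<=` [set v].
  move=> Vv; apply: conv_hull_sub; last by move=> v' /one; apply.
  apply/convex_setP => x y t _ /= -> ->.
  by rewrite -scalerDl addrC subrK scale1r.
move: dimA; rewrite lt0n -leqn0 => /bigmax_leqP[] [[|k] ltk] //=.
move=> /asboolP[x [M [Ax AM Mfree]]]; exfalso.
have [v Vv] : exists v, V v.
  apply: contrapT => nV; suff: (set0 : set pt) x by [].
  apply: conv_hull_sub Ax; first by apply/convex_setP.
  by move=> v Vv; case: nV; exists v.
have := sub1 v Vv _ (AM ord0); rewrite -(sub1 v Vv _ Ax) /= => /eqP.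
rewrite -subr_eq0 addrC addKr => /eqP row0.
have : delta_mx 0 ord0 *m M = 0 *m M :> 'rV[R]_3 by rewrite -rowE row0 mul0mx.
by move/(row_free_inj Mfree)/matrixP/(_ 0 ord0)/eqP; rewrite !mxE !eqxx oner_eq0.
Qed.

Lemma mem_big_mink_sum L (S : 'I_L -> set pt) (t : 'I_L -> pt) :
  (forall i, S i (t i)) ->
  (\big[@mink_sum R 3/[set 0]]_(i < L) S i) (\sum_(i < L) t i).
Proof.
move=> St; elim/big_rec2: _ => [//|i y A _ Ay].
by exists (t i) => //; exists y.
Qed.

(** Each summand has two lattice points whose coordinate differences total at least 1. For each
    coordinate, the sums of the larger and of the smaller endpoints lie in [A], so its differences
    add up to at most [2 B]; three coordinates give [6 B]. *)
Lemma contains_mink_sum_bounded (A : set pt) (B : R) :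
  (forall x, A x -> forall i, `|x 0 i| <= B) ->
  exists N, forall L, contains_mink_sum A L -> (L <= N)%N.
Proof.
move=> AB; exists (Num.bound `|B *+ 6|) => L [S [Spos SA]].
have /choice[xy xyP] : forall i, exists xy : lat * lat,
    [/\ xy.1 != xy.2, S i (realize xy.1) & S i (realize xy.2)].
  move=> i; have [/lattice_polytope_two_points H /H[x [y ?]]] := Spos i.
  by exists (x, y).
pose D i (c : 'I_3) : R := `|zreal ((xy i).1 0 c) - zreal ((xy i).2 0 c)|.
have D1 i : 1 <= \sum_c D i c.
  have [neq _ _] := xyP i.
  have [c /eqP xc] : exists c, (xy i).1 0 c <> (xy i).2 0 c.
    apply: contrapT => nc; case/negP: neq; apply/eqP/rowP => c.
    by apply: contrapT => xc; apply: nc; exists c.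
  rewrite (bigD1 c) //= -[leLHS]addr0; apply: lerD; last first.
    by apply: sumr_ge0 => k _; apply: normr_ge0.
  apply: norm_intr_ge1; first by rewrite rpredB // /zreal intr_int.
  by rewrite subr_eq0 (inj_eq zreal_inj).
have DB c : \sum_i D i c <= B *+ 2.
  have pick (f : 'I_L -> bool) :
      `|\sum_i zreal ((if f i then (xy i).1 else (xy i).2) 0 c)| <= B.
    have /AB/(_ c) : A (\sum_i realize (if f i then (xy i).1 else (xy i).2)).
      apply: SA; apply: mem_big_mink_sum => i.
      by have [_ ? ?] := xyP i; case: ifP.
    by rewrite summxE; under eq_bigr do rewrite mxE.
  pose f i := zreal ((xy i).2 0 c) <= zreal ((xy i).1 0 c).
  have := lerD (pick f) (pick (fun i => ~~ f i)); rewrite -mulr2n; apply: le_trans.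
  apply: le_trans (ler_normB _ _); rewrite -sumrB; apply: le_trans (ler_norm _).
  apply: ler_sum => i _; rewrite /D /f.
  have [le|lt] := leP (zreal ((xy i).2 0 c)) (zreal ((xy i).1 0 c)) => /=.
    by rewrite ger0_norm // subr_ge0.
  by rewrite distrC gtr0_norm // subr_gt0.
rewrite -(ler_nat R); apply: le_trans (ltW (archi_boundP (normr_ge0 _))).
apply: le_trans (ler_norm _).
have -> : L%:R = \sum_(i < L) 1 :> R by rewrite sumr_const card_ord.
apply: le_trans (ler_sum _ (fun i _ => D1 i)) _.
rewrite exchange_big /= (mulrnA B 2 3).
apply: le_trans (ler_sum _ (fun c _ => DB c)) _.
by rewrite sumr_const card_ord.
Qed.

(** The admissible lengths are bounded and [L] is one of them, so a largest exists and [xget] does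
    not return its default. *)
Lemma mink_length_ge (A : set pt) (B : R) (L : nat) :
  (forall x, A x -> forall i, `|x 0 i| <= B) ->
  contains_mink_sum A L -> (L <= mink_length A)%N.
Proof.
move=> AB AL; have [N NP] := contains_mink_sum_bounded AB.
pose p n := `[< contains_mink_sum A n >].
have exp : exists n, p n by exists L; apply/asboolP.
have pN n : p n -> (n <= N)%N by move=> /asboolP; apply: NP.
rewrite /mink_length; case: xgetP => [l _ [_ lmax]|none]; first exact: lmax.
case: (ex_maxnP exp pN) none => m /asboolP Am mmax /(_ m) [].
by split=> // l Al; apply: mmax; apply/asboolP.
Qed.

Lemma num_lattice_pts_enum (A : set pt) n : num_lattice_pts A = n.+1 ->
  exists p : 'I_n.+1 -> lat, injective p /\ forall i, A (realize (p i)).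
Proof.
rewrite /num_lattice_pts => cardA.
set s := enum_fset (fset_set (A `&` @lattice_pts R 3)) in cardA.
have su : uniq s by apply: fset_uniq.
(* On an infinite set [fset_set] is empty, contrary to the positive count. *)
have fin : finite_set (A `&` @lattice_pts R 3).
  apply: contrapT => nfin; move: cardA; rewrite /s /fset_set.
  by case: pselect.
have sA x : x \in s -> A x /\ @lattice_pts R 3 x.
  by rewrite /s -[_ \in _]/(x \in fset_set _) in_fset_set // inE.
have /fin_all_exists[p Ep] : forall i : 'I_n.+1, exists z, nth 0 s i = realize z.
  move=> i; apply: lattice_pts_realize; apply: (sA _ _).2.
  by apply: mem_nth; rewrite cardA.
exists p; split=> [i j /(congr1 realize)|i].
  rewrite -!Ep => /eqP; rewrite nth_uniq ?cardA // => /eqP; exact: val_inj.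
by rewrite -Ep; apply: (sA _ _).1; apply: mem_nth; rewrite cardA.
Qed.

End RealPoints.

Local Close Scope classical_set_scope.
Local Close Scope ring_scope.

Theorem theorem3p23 (R : realType) (P Q : set 'rV[R]_3) :
  lattice_polytope P -> lattice_polytope Q ->
  num_lattice_pts P = 6 -> num_lattice_pts Q = 3 ->
  3 <= mink_length (mink_sum P Q).
Proof.
move=> [V [Vfin _] ->] [W [Wfin _] ->].
move=> /num_lattice_pts_enum[p [pI Pp]] /num_lattice_pts_enum[q [qI Qq]].
have [B1 HB1] := conv_hull_bounded Vfin; have [B2 HB2] := conv_hull_bounded Wfin.
have PQc : convex_set (mink_sum (conv_hull V) (conv_hull W)).
  by apply: mink_sum_convex; apply: conv_hull_convex.
apply: (mink_length_ge (B := B1 + B2)).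
  move=> _ [x Px [y Qy <-]] i; rewrite mxE.
  by apply: le_trans (ler_normD _ _) _; rewrite lerD ?HB1 ?HB2.
apply: zonotope_contains_mink_sum => //.
apply: (lattice_zonotope (realize_convex PQc) pI qI) => i j.
by rewrite realizeD; exists (realize R (p i)) => //; exists (realize R (q j)).
Qed.
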